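(* Let $R$ be a complete equicharacteristic noetherian local domain with algebraically closed residue field $k$ and let $\nu$ be a rational valuation on $R$. Assume that the semigroup $\nu(R\setminus\{0\})$ is finitely generated. Then $(R,\nu)$ is an overweight deformation of its associated graded ring $\mathrm{gr}_\nu R$.
   Context: A valuation $\nu$ of $(R,m)$ whose valuation ring $(R_\nu,m_\nu)$ dominates $R$ is rational if $R/m=R_\nu/m_\nu$. With $\Phi$ its value group, $\mathrm{gr}_\nu R=\bigoplus_{\phi\in\Phi_{\ge0}}\{x\in R:\nu(x)\ge\phi\}/\{x\in R:\nu(x)>\phi\}$. A field of representatives $k\subset R$ is fixed. A weight $w$ on $S=k[[u_1,\dots,u_N]]$ is given by a group homomorphism $\mathbf{Z}^N\to\Phi$ mapping $\mathbf{N}^N$ into $\Phi_{\ge0}$, $w(u^m)=w(m)$ being the image of $m$; the weight of a series is the least weight of its terms, and its initial form is the sum of its terms of least weight. An overweight deformation is the datum of a prime binomial ideal $(u^{m^\ell}-\lambda_\ell u^{n^\ell})_{1\le\ell\le s}$, $\lambda_\ell\in k^*$, of $S$ such that the vectors $m^\ell-n^\ell$ generate the lattice of relations between the $w(u_i)$, and of series $F_\ell=u^{m^\ell}-\lambda_\ell u^{n^\ell}+\sum_{w(p)>w(m^\ell)}c_p^{(\ell)}u^p$, $c^{(\ell)}_p\in k$, whose initial forms generate the ideal of initial forms of all the elements of the ideal $(F_1,\dots,F_s)$. When all $w(u_i)>0$ it determines a rational valuation on $S/(F_1,\dots,F_s)$, by $\nu(x)=\max\{w(\tilde x):\tilde x\in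 S \text{ maps to } x\}$, with associated graded ring $k[U_1,\dots,U_N]/(U^{m^\ell}-\lambda_\ell U^{n^\ell})_{1\le \ell\le s}$, $\deg U_i=w(u_i)$. ''$(R,\nu)$ is an overweight deformation of $\mathrm{gr}_\nu R$'' means: there are such $N$, $w$ with $w(u_i)>0$, and $F_1,\dots,F_s$, and an isomorphism of $k$-algebras $R\cong S/(F_1,\dots,F_s)$ under which $\nu$ is the valuation determined by the overweight deformation, so that $\mathrm{gr}_\nu R\cong k[U_1,\dots,U_N]/(U^{m^\ell}-\lambda_\ell U^{n^\ell})_{1\le \ell\le s}$. *)

(* Defs.v *)
From HB Require Import structures.
From mathcomp Require Import all_boot all_order all_algebra.
From mathcomp Require Import boolp classical_sets.
From mathcomp Require Import monalg.

Set Implicit Arguments.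
Unset Strict Implicit.
Unset Printing Implicit Defensive.

Import Order.TTheory GRing.Theory Num.Theory.
Import Quotient.Exports.

Local Open Scope classical_set_scope.
Local Open Scope ring_scope.
Local Open Scope quotient_scope.

Notation "x %:F" := (FracField.tofrac x) : ring_scope.

(** * Ideals and local rings *)

Section Ideals.
Variable A : comNzRingType.
Implicit Types (I J X : set A).

Definition is_ideal I :=
  [/\ I 0, forall x y, I x -> I y -> I (x + y) & forall a x, I x -> I (a * x)].

Definition ideal_gen X : set A := smallest is_ideal X.

Definition prime_ideal I :=
  [/\ is_ideal I, ~ I 1 & forall x y, I (x * y) -> I x \/ I y].

Definition maximal_ideal I :=
  [/\ is_ideal I, ~ I 1 &
      forall J, is_ideal J -> ~ J 1 -> I `<=` J -> J = I].

Definition local_ring (m : set A) :=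
  maximal_ideal m /\ forall m', maximal_ideal m' -> m' = m.

Definition noetherian :=
  forall I, is_ideal I -> exists s : seq A, I = ideal_gen [set` s].

Definition ideal_mul I J := ideal_gen [set x * y | x in I & y in J].

Definition ideal_pow I n := iter n (ideal_mul I) [set: A].

(* Separated and complete for the [m]-adic topology. *)
Definition adic_complete (m : set A) :=
  (forall x, (forall n, ideal_pow m n x) -> x = 0) /\
  (forall u : nat -> A,
     (forall n, exists M, forall i j, (M <= i)%N -> (M <= j)%N ->
        ideal_pow m n (u i - u j)) ->
     exists l, forall n, exists M, forall i, (M <= i)%N ->
        ideal_pow m n (u i - l)).

(* [A] and [A / m] have the same characteristic. *)
Definition equicharacteristic (m : set A) :=
  forall n : nat, n%:R = 0 :> A <-> m n%:R.

(* The composite [k -> A -> A / m] is bijective. *)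
Definition field_of_representatives (k : fieldType) (m : set A)
    (iota : {rmorphism k -> A}) :=
  forall x, exists! c : k, m (x - iota c).

End Ideals.

(** * Ordered groups and valuations *)

(* Totality is a field of the mixin, rather than inherited from [Order.Total],
   because Hierarchy Builder would require joins missing from MathComp. *)
HB.mixin Record isOrderedAbGroup G of Num.POrderedZmodule G := {
  oag_le_total : total (<=%R : rel G);
  oag_lerD2r : forall z : G, {homo (fun x => x + z) : x y / x <= y}
}.

#[short(type="orderedAbGroupType")]
HB.structure Definition OrderedAbGroup :=
  {G of Num.POrderedZmodule G & isOrderedAbGroup G}.

(* Values at 0 are irrelevant (the value there is conventionally infinite);
   surjectivity says that [G] is the value group. *)
Record valuation (K : fieldType) (G : orderedAbGroupType) := Valuation {
  val_fun :> K -> G;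
  val_funM : forall x y, x != 0 -> y != 0 ->
    val_fun (x * y) = val_fun x + val_fun y;
  val_funD : forall x y, x != 0 -> y != 0 -> x + y != 0 ->
    Order.min (val_fun x) (val_fun y) <= val_fun (x + y);
  val_fun_surj : forall g, exists2 x, x != 0 & val_fun x = g
}.


Section OrderedAbGroupTheory.
Variable G : orderedAbGroupType.
Implicit Types g h : G.

Lemma oag_lerD g1 g2 h1 h2 : g1 <= h1 -> g2 <= h2 -> g1 + g2 <= h1 + h2.
Proof.
move=> l1 l2; apply: (le_trans (oag_lerD2r g2 _ _ l1)).
by rewrite ![h1 + _]addrC; exact: oag_lerD2r.
Qed.

Lemma oag_ler_ltD g1 g2 h1 h2 : g1 <= h1 -> g2 < h2 -> g1 + g2 < h1 + h2.
Proof.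
move=> l1 l2; apply: (le_lt_trans (oag_lerD2r g2 _ _ l1)).
rewrite lt_neqAle oag_lerD ?lexx ?ltW // andbT.
by apply: contraTneq l2 => /addrI ->; rewrite ltxx.
Qed.

Lemma oag_double0 g : g + g = 0 -> g = 0.
Proof.
move=> e; case/orP: (oag_le_total g 0) => l; apply/eqP; rewrite eq_le l /=.
- by have := oag_lerD l (lexx g); rewrite e add0r.
- by have := oag_lerD l (lexx g); rewrite e add0r andbT.
Qed.

End OrderedAbGroupTheory.

Section Valuations.
Variables (K : fieldType) (G : orderedAbGroupType) (v : valuation K G).
Implicit Types (x y : K) (g h : G).

Definition val_ge g x := (x == 0) || (g <= v x).
Definition val_gt g x := (x == 0) || (g < v x).

Lemma val_fun1 : v 1 = 0.
Proof.
apply: (@addrI _ (v 1)).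
by rewrite -val_funM ?oner_neq0 // mulr1 addr0.
Qed.

Lemma val_funN x : v (- x) = v x.
Proof.
have [->|x0] := eqVneq x 0; first by rewrite oppr0.
have n0 : (-1 : K) != 0 by rewrite oppr_eq0 oner_neq0.
rewrite -mulN1r val_funM // (_ : v (-1) = 0) ?add0r //.
by apply: oag_double0; rewrite -val_funM // mulrNN mulr1 val_fun1.
Qed.

Lemma val_ge0 g : val_ge g 0. Proof. by rewrite /val_ge eqxx. Qed.
Lemma val_gt0 g : val_gt g 0. Proof. by rewrite /val_gt eqxx. Qed.

Lemma val_geD g x y : val_ge g x -> val_ge g y -> val_ge g (x + y).
Proof.
rewrite /val_ge; have [->|x0] := eqVneq x 0; first by rewrite add0r.
have [->|y0] := eqVneq y 0; first by rewrite addr0 (negbTE x0).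
have [//|s0 /= lx ly] := eqVneq (x + y) 0.
by apply: le_trans (val_funD v x0 y0 s0); rewrite /Order.min; case: ifP.
Qed.

Lemma val_gtD g x y : val_gt g x -> val_gt g y -> val_gt g (x + y).
Proof.
rewrite /val_gt; have [->|x0] := eqVneq x 0; first by rewrite add0r.
have [->|y0] := eqVneq y 0; first by rewrite addr0 (negbTE x0).
have [//|s0 /= lx ly] := eqVneq (x + y) 0.
by apply: lt_le_trans (val_funD v x0 y0 s0); rewrite /Order.min; case: ifP.
Qed.

Lemma val_geN g x : val_ge g x -> val_ge g (- x).
Proof. by rewrite /val_ge oppr_eq0 val_funN. Qed.

Lemma val_gtN g x : val_gt g x -> val_gt g (- x).
Proof. by rewrite /val_gt oppr_eq0 val_funN. Qed.

Lemma val_geM g h x y : val_ge g x -> val_ge h y -> val_ge (g + h) (x * y).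
Proof.
rewrite /val_ge mulf_eq0; have [//|x0] := eqVneq x 0.
have [//|y0 /= lx ly] := eqVneq y 0.
by rewrite val_funM // oag_lerD.
Qed.

Lemma val_ge_gtM g h x y : val_ge g x -> val_gt h y -> val_gt (g + h) (x * y).
Proof.
rewrite /val_ge /val_gt mulf_eq0; have [//|x0] := eqVneq x 0.
have [//|y0 /= lx ly] := eqVneq y 0.
by rewrite val_funM // oag_ler_ltD.
Qed.

End Valuations.

Section ValuationsOnDomain.
Variables (R : idomainType) (G : orderedAbGroupType).
Variable (v : valuation {fraction R} G).

(* The valuation ring [{z | val_ge v 0 z}] contains [R], and its maximal ideal
   [{z | val_gt v 0 z}] meets [R] in [m]. *)
Definition dominates (m : set R) :=
  (forall x : R, val_ge v 0 x%:F) /\ (forall x : R, m x <-> val_gt v 0 x%:F).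

(* Given domination, [R / m] embeds in the residue field of [v]; this says that
   the embedding is onto. *)
Definition rational_valuation :=
  forall z : {fraction R}, val_ge v 0 z -> exists x : R, val_gt v 0 (z - x%:F).

Definition value_semigroup : set G := [set v x%:F | x in [set x : R | x != 0]].

End ValuationsOnDomain.

Definition fg_semigroup (G : nmodType) (Gamma : set G) :=
  exists (r : nat) (g : 'I_r -> G),
    Gamma = [set \sum_i g i *+ a i | a in [set: 'I_r -> nat]].

(** * The associated graded ring *)

Section NonNegative.
Variable G : orderedAbGroupType.

Record nneg := NNeg { nneg_val :> G; nneg_valP : 0 <= nneg_val }.

HB.instance Definition _ := [isSub for nneg_val].
HB.instance Definition _ := [Choice of nneg by <:].

Implicit Types g h : nneg.

Definition nneg_zero : nneg := NNeg (lexx 0).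

Lemma nneg_add_subproof g h : 0 <= nneg_val g + nneg_val h.
Proof. by rewrite -[0]addr0 oag_lerD ?nneg_valP. Qed.

Definition nneg_add g h : nneg := NNeg (nneg_add_subproof g h).

Lemma nneg_addA : associative nneg_add.
Proof. by move=> g h l; apply: val_inj; rewrite /= addrA. Qed.

Lemma nneg_add0 : left_id nneg_zero nneg_add.
Proof. by move=> g; apply: val_inj; rewrite /= add0r. Qed.

Lemma nneg_addC : commutative nneg_add.
Proof. by move=> g h; apply: val_inj; rewrite /= addrC. Qed.

Lemma nneg_addr0 : right_id nneg_zero nneg_add.
Proof. by move=> g; rewrite nneg_addC nneg_add0. Qed.

Lemma nneg_conical g h :
  nneg_add g h = nneg_zero -> g = nneg_zero /\ h = nneg_zero.
Proof.
move=> e; suff h0 : h = nneg_zero by move: e; rewrite h0 nneg_addr0.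
apply: val_inj => /=; move/(congr1 nneg_val): e => /= e.
apply/eqP; rewrite eq_le nneg_valP andbT.
by have := oag_lerD (nneg_valP g) (lexx (nneg_val h)); rewrite e add0r.
Qed.

HB.instance Definition _ := Choice_isMonomialDef.Build nneg
  nneg_addA nneg_add0 nneg_addr0 nneg_conical.
HB.instance Definition _ := MonomialDef_isConomialDef.Build nneg nneg_addC.

End NonNegative.

Section AssociatedGradedRing.
Variables (R : idomainType) (G : orderedAbGroupType).
Variable (v : valuation {fraction R} G).

Local Notation RG := {malg R[nneg G]}.

(* [gr_v R], the direct sum of the P_g / P_g^+ where P_g = {x | v x >= g} and
   P_g^+ = {x | v x > g}, is realised as the quotient of the subring [rees] =
   sum of the P_g t^g of the monoid algebra R[t^(G>=0)] by its ideal
   [rees_plus] = sum of the P_g^+ t^g. *)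

Definition rees_pred : {pred RG} :=
  fun f => `[< forall g : nneg G, val_ge v (nneg_val g) (f@_g)%:F >].

Lemma val_ge_sum (I : eqType) (r : seq I) (F : I -> R) g :
  (forall i, i \in r -> val_ge v g (F i)%:F) -> val_ge v g (\sum_(i <- r) F i)%:F.
Proof.
move=> h; rewrite big_seq; elim/big_ind: _ => //.
- by rewrite tofrac0 val_ge0.
- by move=> x y hx hy; rewrite tofracD val_geD.
Qed.

Lemma val_gt_sum (I : eqType) (r : seq I) (F : I -> R) g :
  (forall i, i \in r -> val_gt v g (F i)%:F) -> val_gt v g (\sum_(i <- r) F i)%:F.
Proof.
move=> h; rewrite big_seq; elim/big_ind: _ => //.
- by rewrite tofrac0 val_gt0.
- by move=> x y hx hy; rewrite tofracD val_gtD.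
Qed.

Lemma rees_subring_closed : subring_closed rees_pred.
Proof.
split.
- apply/asboolP => g; rewrite mcoeff1.
  case: eqP => [->|_]; last by rewrite tofrac0 val_ge0.
  by rewrite tofrac1 /val_ge val_fun1 lexx orbT.
- move=> f1 f2 /asboolP h1 /asboolP h2; apply/asboolP => g.
  by rewrite mcoeffB tofracB val_geD // val_geN.
- move=> f1 f2 /asboolP h1 /asboolP h2; apply/asboolP => g.
  rewrite mcoeffMl.
  apply: val_ge_sum => g1 _; apply: val_ge_sum => g2 _.
  case: eqP => [<-|_]; last by rewrite tofrac0 val_ge0.
  by rewrite mulr1n tofracM val_geM.
Qed.

HB.instance Definition _ := GRing.isSubringClosed.Build _ rees_pred
  rees_subring_closed.

Record rees := Rees { rees_val :> RG; rees_valP : rees_val \in rees_pred }.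

HB.instance Definition _ := [isSub for rees_val].
HB.instance Definition _ := [Choice of rees by <:].
HB.instance Definition _ := [SubChoice_isSubComNzRing of rees by <:].

Definition rees_plus : {pred rees} :=
  fun f => `[< forall g : nneg G, val_gt v (nneg_val g) ((rees_val f)@_g)%:F >].

Lemma rees_plus_idealr : idealr_closed rees_plus.
Proof.
split.
- by apply/asboolP => g; rewrite raddf0 tofrac0 val_gt0.
- apply/negP => /asboolP /(_ (nneg_zero G)).
  rewrite mcoeff1 eqxx tofrac1 /val_gt val_fun1 ltxx.
  by rewrite oner_eq0.
- move=> a f1 f2 /asboolP h1 /asboolP h2; apply/asboolP => g.
  rewrite mcoeffD tofracD val_gtD //.
  rewrite mcoeffMl.
  apply: val_gt_sum => g1 _; apply: val_gt_sum => g2 _.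
  case: eqP => [<-|_]; last by rewrite tofrac0 val_gt0.
  rewrite mulr1n tofracM val_ge_gtM //.
  by have /asboolP := rees_valP a; apply.
Qed.

HB.instance Definition _ := isIdealr.Build rees rees_plus rees_plus_idealr.

Definition gr := {ideal_quot rees_plus}.

HB.instance Definition _ := GRing.ComNzRing.on gr.

(* [gr_symbol g x] holds of the class of [x] in P_g / P_g^+. *)
Definition gr_symbol (g : nneg G) (x : R) (z : gr) :=
  exists2 f : rees, rees_val f = << x *g g >> & z = \pi_gr f.

Definition gr_component (g : nneg G) : set gr :=
  [set z | exists x : R, gr_symbol g x z].

End AssociatedGradedRing.

(* Imported only here because its notations clash with those of [monalg]; the
   one for polynomials is restored, as [monalg] has its own in [type_scope]. *)
From mathcomp Require Import mpoly.
Notation "{ 'mpoly' T [ n ] }" := (mpoly n T) : type_scope.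

(** * Formal power series in [N] variables *)

Definition fps (N : nat) (k : comNzRingType) := 'X_{1..N} -> k.

Notation "{ 'fps' k [ N ] }" := (fps N k) (format "{ 'fps'  k [ N ] }").

Section PowerSeries.
Variables (N : nat) (k : comNzRingType).
Implicit Types (f g h : {fps k[N]}) (p q : 'X_{1..N}) (c : k).

HB.instance Definition _ := gen_eqMixin {fps k[N]}.
HB.instance Definition _ := gen_choiceMixin {fps k[N]}.

Definition fps_const c : {fps k[N]} := fun p => if p == 0%MM then c else 0.
Definition fps_monom q : {fps k[N]} := fun p => (p == q)%:R.
Definition fps_zero : {fps k[N]} := fun=> 0.
Definition fps_opp f : {fps k[N]} := fun p => - f p.
Definition fps_add f g : {fps k[N]} := fun p => f p + g p.
Definition fps_mul f g : {fps k[N]} := fun p =>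
  \sum_(q : 'X_{1..N < (mdeg p).+1} | (q <= p)%MM) f q * g (p - q)%MM.

Lemma fps_addA : associative fps_add.
Proof. by move=> f g h; apply: funext => p; rewrite /fps_add addrA. Qed.
Lemma fps_addC : commutative fps_add.
Proof. by move=> f g; apply: funext => p; rewrite /fps_add addrC. Qed.
Lemma fps_add0 : left_id fps_zero fps_add.
Proof. by move=> f; apply: funext => p; rewrite /fps_add add0r. Qed.
Lemma fps_addN : left_inverse fps_zero fps_opp fps_add.
Proof. by move=> f; apply: funext => p; rewrite /fps_add addNr. Qed.

HB.instance Definition _ := GRing.isZmodule.Build {fps k[N]}
  fps_addA fps_addC fps_add0 fps_addN.

Definition fps_trunc b f : {mpoly k[N]} :=
  \sum_(p : 'X_{1..N < b}) f p *: 'X_[p].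

Lemma fps_truncE b f p : (mdeg p < b)%N -> (fps_trunc b f)@_p = f p.
Proof. exact: mcoeff_mpoly. Qed.

Lemma fps_mulE f g p (P Q : {mpoly k[N]}) :
    (forall q, (mdeg q <= mdeg p)%N -> P@_q = f q) ->
    (forall q, (mdeg q <= mdeg p)%N -> Q@_q = g q) ->
  fps_mul f g p = (P * Q)@_p.
Proof.
move=> hP hQ; rewrite (@mcoeff_poly_mul_lin _ _ P Q p _ (ltnSn _)).
apply: eq_bigr => q _; rewrite hP ?hQ //; first exact: mdegB.
by rewrite -ltnS bmdeg.
Qed.

Lemma fps_mulC : commutative fps_mul.
Proof.
move=> f g; apply: funext => p.
pose T := fps_trunc (mdeg p).+1.
have hT h q : (mdeg q <= mdeg p)%N -> (T h)@_q = h q.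
  by move=> lq; apply: fps_truncE; rewrite ltnS.
by rewrite (fps_mulE (hT f) (hT g)) (fps_mulE (hT g) (hT f)) mulrC.
Qed.

Lemma fps_mulA : associative fps_mul.
Proof.
move=> f g h; apply: funext => p.
pose T := fps_trunc (mdeg p).+1.
have hT e q : (mdeg q <= mdeg p)%N -> (T e)@_q = e q.
  by move=> lq; apply: fps_truncE; rewrite ltnS.
have hM e1 e2 q : (mdeg q <= mdeg p)%N -> (T e1 * T e2)@_q = fps_mul e1 e2 q.
  by move=> lq; rewrite (@fps_mulE _ _ _ (T e1) (T e2)) // => r lr;
     apply: hT; exact: leq_trans lq.
by rewrite (fps_mulE (hT f) (hM g h)) (fps_mulE (hM f g) (hT h)) mulrA.
Qed.

Lemma fps_constE c p : (c%:MP : {mpoly k[N]})@_p = fps_const c p.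
Proof. by rewrite mcoeffC /fps_const eq_sym; case: eqP; rewrite ?mulr1 ?mulr0. Qed.

Lemma fps_mul1 : left_id (fps_const 1) fps_mul.
Proof.
move=> f; apply: funext => p.
have hT q : (mdeg q <= mdeg p)%N -> (fps_trunc (mdeg p).+1 f)@_q = f q.
  by move=> lq; apply: fps_truncE; rewrite ltnS.
by rewrite (fps_mulE (fun q _ => fps_constE 1 q) hT) mul1r hT.
Qed.

Lemma fps_mulDl : left_distributive fps_mul fps_add.
Proof.
move=> f g h; apply: funext => p; rewrite /fps_add /fps_mul -big_split /=.
by apply: eq_bigr => q _; rewrite mulrDl.
Qed.

Lemma fps_1neq0 : fps_const 1 != 0.
Proof.
apply/eqP => /(congr1 (fun f => f 0%MM)); rewrite /fps_const eqxx.
by apply/eqP; exact: oner_neq0.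
Qed.

HB.instance Definition _ := GRing.Zmodule_isComNzRing.Build {fps k[N]}
  fps_mulA fps_mulC fps_mul1 fps_mulDl fps_1neq0.

Definition fps_binom c p q : {fps k[N]} :=
  fps_monom p - fps_const c * fps_monom q.

End PowerSeries.

(** * Weights and overweight deformations *)

Section Weights.
Variables (N : nat) (k : fieldType) (G : orderedAbGroupType).
Variable w : {additive 'rV[int]_N -> G}.
Implicit Types (f : {fps k[N]}) (p q : 'X_{1..N}).

Definition expvec p : 'rV[int]_N := \row_i (p i)%:Z.

Definition wt p : G := w (expvec p).

Definition is_weight := forall p, 0 <= wt p.

(* [0] has no weight. *)
Definition has_weight f (g : G) :=
  (exists2 p, f p != 0 & wt p = g) /\ (forall p, f p != 0 -> g <= wt p).

Definition initial_form f : {fps k[N]} := fun p =>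
  if `[< forall q, f q != 0 -> wt p <= wt q >] then f p else 0.

(* The data: exponents [a l], [b l] (the m^l and n^l), coefficients [c l],
   series [F l]. *)
Definition overweight_deformation (s : nat) (a b : 'I_s -> 'X_{1..N})
    (c : 'I_s -> k) (F : 'I_s -> {fps k[N]}) :=
  [/\ is_weight,
      forall l, a l != b l /\ c l != 0,
      prime_ideal (ideal_gen (range (fun l => fps_binom (c l) (a l) (b l)))),
      forall z : 'rV[int]_N, w z = 0 <->
        exists d : 'I_s -> int, z = \sum_l (expvec (a l) - expvec (b l)) *~ d l &
      (forall l p, (F l - fps_binom (c l) (a l) (b l)) p != 0 ->
         wt (a l) < wt p) /\
      ideal_gen (range (fun l => initial_form (F l))) =
        ideal_gen (initial_form @` ideal_gen (range F))].

End Weights.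

Section IsOverweightDeformation.
Variables (k : fieldType) (R : idomainType) (iota : {rmorphism k -> R}).
Variables (G : orderedAbGroupType) (v : valuation {fraction R} G).

(* [g] is the maximum of the weights of the lifts of [x] to power series. *)
Definition max_lift_weight (N : nat) (w : {additive 'rV[int]_N -> G})
    (I : idealr {fps k[N]}) (x : {ideal_quot I}) (g : G) :=
  (exists2 f, x = \pi_({ideal_quot I}) f & has_weight w f g) /\
  (forall f h, x = \pi_({ideal_quot I}) f -> has_weight w f h -> h <= g).

(* [(R, v)] is isomorphic to the quotient by the ideal [F] with the valuation
   determined by [w]. *)
Definition presented_by (N : nat) (w : {additive 'rV[int]_N -> G}) (s : nat)
    (F : 'I_s -> {fps k[N]}) :=
  exists2 I : idealr {fps k[N]}, [set` I] = ideal_gen (range F) &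
  exists phi : {rmorphism {ideal_quot I} -> R},
    [/\ bijective phi,
        forall c, phi (\pi_({ideal_quot I}) (fps_const c)) = iota c &
        forall x, x != 0 -> max_lift_weight w x (v (phi x)%:F)].

(* Graded isomorphism of k-algebras of k[U_1, ..., U_N] modulo the binomials
   onto [gr v], where U_i has degree [w(u_i)]. *)
Definition gr_presented_by (N : nat) (w : {additive 'rV[int]_N -> G}) (s : nat)
    (a b : 'I_s -> 'X_{1..N}) (c : 'I_s -> k) :=
  exists2 J : idealr {mpoly k[N]},
    [set` J] = ideal_gen (range (fun l => 'X_[a l] - c l *: 'X_[b l])) &
  exists psi : {rmorphism {ideal_quot J} -> gr v},
    [/\ bijective psi,
        forall e, gr_symbol (nneg_zero G) (iota e)
          (psi (\pi_({ideal_quot J}) e%:MP)) &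
        forall (g : nneg G) (P : {mpoly k[N]}),
          (forall p, p \in msupp P -> wt w p = g) ->
          gr_component g (psi (\pi_({ideal_quot J}) P))].

Definition is_overweight_deformation_of_gr :=
  exists (N s : nat) (w : {additive 'rV[int]_N -> G})
    (a b : 'I_s -> 'X_{1..N}) (c : 'I_s -> k) (F : 'I_s -> {fps k[N]}),
    [/\ overweight_deformation w a b c F,
        forall i, 0 < wt w U_(i)%MM,
        presented_by w F &
        gr_presented_by w a b c].

End IsOverweightDeformation.

(* Main.v *)
(** Choose [xi_1, ..., xi_N] in [R] whose values are the positive generators of
    the value semigroup. As [R] is complete, [u_i |-> xi_i] extends to a
    morphism [phi : k[[u_1, ..., u_N]] -> R], and by Dickson's lemma a series
    of weight at least [g] is a combination of finitely many monomials of weight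
    at least [g], so [nu (phi f)] is at least the weight of [f]. By the same
    lemma the weights are well-ordered. Since [nu] is rational, the leading
    part of an element of [R] is the image of a term [c u^p]; subtracting
    leading parts transfinitely writes every [x] as [phi f] with [f] of weight
    [nu x].
    The pairs of monomials of equal weight form a finitely generated monoid,
    again by Dickson's lemma, so finitely many binomials [B_l] generate all the
    homogeneous relations modulo higher values. Expanding [phi B_l] gives
    [F_l = B_l - (terms of higher weight)] in the kernel of [phi]; a second
    transfinite process divides any element of the kernel by the [F_l]. The same
    division with [F_l = B_l] identifies the ideal of the [B_l] with the set of
    series all of whose homogeneous components have image of higher value than
    their weight, and this set is a prime ideal because [nu] is a valuation. *)
Require Import Defs.
From HB Require Import structures.
From mathcomp Require Import all_boot all_order all_algebra.
From mathcomp Require Import boolp classical_sets ring.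
From mathcomp Require Import monalg.
(* [mpoly] is imported after [monalg], as in [Defs], so that it wins the name
   clashes; its notation for polynomials has to be restored. *)
From mathcomp Require Import mpoly.
Notation "{ 'mpoly' T [ n ] }" := (mpoly n T) : type_scope.

Set Implicit Arguments.
Unset Strict Implicit.
Unset Printing Implicit Defensive.

Import Order.TTheory GRing.Theory Num.Theory.
Import Quotient.Exports.

Local Open Scope classical_set_scope.
Local Open Scope ring_scope.
Local Open Scope quotient_scope.

(** * Dickson's lemma *)

(** Each chosen index minimises [u] over a whole tail of indices, and all later choices lie in that
    tail. *)
Lemma nat_mono_subseq (u : nat -> nat) :
  exists h : nat -> nat, (forall i j, (i < j)%N -> (h i < h j)%N) /\
    (forall i j, (i <= j)%N -> (u (h i) <= u (h j))%N).
Proof.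
have hmin n : exists m, (n <= m)%N /\ forall k, (n <= k)%N -> (u m <= u k)%N.
  have exP : exists v, `[< exists2 m, (n <= m)%N & u m = v >].
    by exists (u n); apply/asboolP; exists n.
  case: (ex_minnP exP) => v /asboolP[m nm umv] vmin.
  exists m; split=> // k nk; rewrite umv; apply: vmin.
  by apply/asboolP; exists k.
have [t ht] := choice hmin.
pose h := fix h n := if n is n'.+1 then t (h n').+1 else t 0%N.
have hS i : (h i < h i.+1)%N by exact: (ht (h i).+1).1.
have hlt i j : (i < j)%N -> (h i < h j)%N.
  elim: j => // j IH; rewrite ltnS leq_eqVlt => /predU1P[->|/IH l]; first exact: hS.
  exact: ltn_trans l (hS j).
exists h; split=> // i j; rewrite leq_eqVlt => /predU1P[->//|ij].
case: i ij => [|i] ij; first exact: (ht 0%N).2.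
by apply: (ht (h i).+1).2; apply: hlt; exact: ltn_trans ij.
Qed.

(** If no finite [s] worked, a sequence in [A] could be chosen greedily with no term above an
    earlier one; extracting a monotone subsequence for each coordinate in turn contradicts this. The
    map [e] is arbitrary so that the lemma serves for exponents and for pairs of exponents. *)
Lemma dickson (I : finType) (T : choiceType) (e : T -> I -> nat) (A : set T) :
  exists2 s : seq T, [set` s] `<=` A &
    forall p, A p -> exists2 q, q \in s & forall i, (e q i <= e p i)%N.
Proof.
apply: contrapT => hA.
have [a0 Aa0] : exists x, A x.
  by apply: contrapT => A0; apply: hA; exists [::] => // p Ap; case: A0; exists p.
have next (s : seq T) : exists x, [set` s] `<=` A ->
    A x /\ forall q, q \in s -> ~ forall i, (e q i <= e x i)%N.
  have [sA|nsA] := pselect ([set` s] `<=` A); last first.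
    (* An arbitrary value: [choice] asks for a witness for every [s], also for those outside [A]. *)
    by exists a0 => sA; case: nsA.
  apply: contrapT => hs; apply: hA; exists s => // p Ap.
  apply: contrapT => np; apply: hs; exists p => _; split=> // q qs le.
  by apply: np; exists q.
have [t ht] := choice next.
pose S := fix S n := if n is n'.+1 then t (S n') :: S n' else [::].
have SA n : [set` S n] `<=` A.
  elim: n => [//|n IH] x; rewrite /= inE => /predU1P[->|/IH//].
  exact: (ht _ IH).1.
pose x n := t (S n).
have xS i j : (i < j)%N -> x i \in S j.
  elim: j => // j IH; rewrite ltnS leq_eqVlt /= inE => /predU1P[->|/IH->].
    by rewrite eqxx.
  by rewrite orbT.
have bad i j : (i < j)%N -> ~ forall l, (e (x i) l <= e (x j) l)%N.
  by move=> ij; apply: (ht _ (SA j)).2; exact: xS.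
have [h [hlt hmono]] : exists h : nat -> nat,
    (forall i j, (i < j)%N -> (h i < h j)%N) /\
    forall l, l \in enum I -> forall i j, (i <= j)%N -> (e (x (h i)) l <= e (x (h j)) l)%N.
  elim: (enum I) => [|l s [h [hlt hmono]]]; first by exists id.
  have [h' [h'lt h'mono]] := nat_mono_subseq (fun n => e (x (h n)) l).
  exists (h \o h'); split=> [i j /h'lt/hlt//|l']; rewrite inE => /predU1P[->|l's] i j ij.
    exact: h'mono.
  apply: hmono => //; move: ij; rewrite leq_eqVlt => /predU1P[->//|/h'lt/ltnW//].
apply: (@bad (h 0%N) (h 1%N)); first exact: hlt.
by move=> l; apply: hmono; rewrite ?mem_enum.
Qed.

(** [F] takes a total function but reads it only below [t], so the values elsewhere may be filled
    with the default [u0]. This drives both transfinite processes. *)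
Lemma wf_recursion (T U : Type) (u0 : U) (lt : T -> T -> Prop)
    (F : T -> (T -> U) -> U) :
  well_founded lt ->
  (forall t c c', (forall s, lt s t -> c s = c' s) -> F t c = F t c') ->
  exists c, forall t, c t = F t c.
Proof.
move=> wf Fext.
pose ext t (rec : forall s, lt s t -> U) s :=
  if pselect (lt s t) is left st then rec s st else u0.
pose c := Fix wf (fun=> U) (fun t rec => F t (ext t rec)).
exists c => t; rewrite /c Fix_eq => [|x f g fg].
  by apply: Fext => s st; rewrite /ext; case: pselect.
by congr F; apply: funext => s; rewrite /ext; case: pselect.
Qed.

(** * Ideals *)

Section IdealLemmas.
Variable A : comNzRingType.
Implicit Types (I X : set A).

Lemma ideal_gen_ideal X : is_ideal (ideal_gen X).
Proof.
split=> [I [[]] //|x y Xx Xy I [idI XI]|a x Xx I [idI XI]].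
  by case: (idI) => _ ID _; apply: ID; [exact: Xx|exact: Xy].
by case: (idI) => _ _; apply; exact: Xx.
Qed.

Lemma ideal_genS X : X `<=` ideal_gen X. Proof. exact: sub_gen_smallest. Qed.

Lemma ideal_gen_min X I : is_ideal I -> X `<=` I -> ideal_gen X `<=` I.
Proof. exact: smallest_sub. Qed.

Section Closure.
Variables (I : set A) (idI : is_ideal I).

Lemma ideal_zero : I 0. Proof. by case: idI. Qed.
Lemma ideal_add x y : I x -> I y -> I (x + y). Proof. by case: idI => _ + _; apply. Qed.
Lemma ideal_mull a x : I x -> I (a * x). Proof. by case: idI => _ _; apply. Qed.
Lemma ideal_mulr a x : I x -> I (x * a). Proof. by rewrite mulrC; exact: ideal_mull. Qed.
Lemma ideal_opp x : I x -> I (- x). Proof. by rewrite -mulN1r; exact: ideal_mull. Qed.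
Lemma ideal_sub x y : I x -> I y -> I (x - y).
Proof. by move=> Ix Iy; apply: ideal_add => //; exact: ideal_opp. Qed.

Lemma ideal_sum (J : Type) (r : seq J) (P : pred J) (F : J -> A) :
  (forall i, P i -> I (F i)) -> I (\sum_(i <- r | P i) F i).
Proof. by move=> h; apply: (big_ind I); [exact: ideal_zero|exact: ideal_add|]. Qed.

End Closure.

Lemma ideal_gen_lin (s : nat) (F h : 'I_s -> A) :
  ideal_gen (range F) (\sum_l h l * F l).
Proof.
apply: (ideal_sum (ideal_gen_ideal _)) => l _.
by apply: (ideal_mull (ideal_gen_ideal _)); apply: ideal_genS; exists l.
Qed.

Section Powers.
Variable m : set A.

Lemma ideal_pow_ideal n : is_ideal (ideal_pow m n).
Proof. by case: n => [|n]; [split|exact: ideal_gen_ideal]. Qed.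

Lemma ideal_pow_mul n x y : m x -> ideal_pow m n y -> ideal_pow m n.+1 (x * y).
Proof. by move=> mx my; apply: ideal_genS; exists x => //; exists y. Qed.

Lemma ideal_powS n : ideal_pow m n.+1 `<=` ideal_pow m n.
Proof.
apply: ideal_gen_min; first exact: ideal_pow_ideal.
by move=> _ [x _ [y my <-]]; apply: ideal_mull my; exact: ideal_pow_ideal.
Qed.

Lemma ideal_powW i j : (i <= j)%N -> ideal_pow m j `<=` ideal_pow m i.
Proof.
elim: j => [|j IH]; first by rewrite leqn0 => /eqP ->.
rewrite leq_eqVlt => /predU1P[-> //|/IH h] x /ideal_powS; exact: h.
Qed.

Lemma ideal_pow_expl n e x y : m x -> ideal_pow m n y ->
  ideal_pow m (e + n) (x ^+ e * y).
Proof.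
move=> mx my; elim: e => [|e IH]; first by rewrite mul1r.
by rewrite exprS -mulrA addSn; exact: ideal_pow_mul.
Qed.

Lemma mmap1_ideal_pow (N : nat) (xi : 'I_N -> A) (p : 'X_{1..N}) :
  (forall i, m (xi i)) -> ideal_pow m (mdeg p) (mmap1 xi p).
Proof.
move=> mxi; rewrite mdegE /mmap1.
apply: (big_rec2 (fun d y => ideal_pow m d y)) => // i d y _ h.
exact: ideal_pow_expl.
Qed.

End Powers.
End IdealLemmas.

Lemma kernel_ideal (A B : comNzRingType) (f : {rmorphism A -> B}) :
  is_ideal [set x | f x = 0].
Proof.
split=> [|x y|a x] /=; rewrite ?rmorph0 ?rmorphD ?rmorphM //.
  by move=> -> ->; rewrite addr0.
by move=> ->; rewrite mulr0.
Qed.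

(** The first isomorphism theorem without surjectivity: the induced map is [f] on canonical
    representatives. The kernel is packed as a boolean predicate, the form in which [ideal_quot]
    takes its ideal. *)
Lemma quotient_by_kernel (A B : comNzRingType) (f : {rmorphism A -> B}) :
  exists2 I : idealr A, [set` I] = [set x | f x = 0] &
  exists phi : {rmorphism {ideal_quot I} -> B},
    injective phi /\ forall x, phi (\pi_({ideal_quot I}) x) = f x.
Proof.
pose K : {pred A} := fun x => f x == 0.
have idK : idealr_closed K.
  split; rewrite ?unfold_in; first by rewrite rmorph0.
    by rewrite rmorph1 oner_neq0.
  move=> a u v; rewrite !unfold_in rmorphD rmorphM => /eqP-> /eqP->.
  by rewrite mulr0 addr0.
pose I : idealr A := HB.pack K (isIdealr.Build A K idK).
exists I.
  by apply/seteqP; split=> x /=; [move/eqP|move=> fx0; apply/eqP].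
pose phi (x : {ideal_quot I}) : B := f (repr x).
have phiE x : phi (\pi x) = f x.
  rewrite /phi; apply/eqP; rewrite -subr_eq0 -rmorphB.
  change (repr (\pi_({ideal_quot I}) x) - x \in I).
  by rewrite Quotient.idealrBE reprK.
have phiB : zmod_morphism phi.
  by move=> x y; rewrite -[x]reprK -[y]reprK -[LHS]/(phi _) -rmorphB !phiE rmorphB.
have phiM : monoid_morphism phi.
  split; first by rewrite -(rmorph1 (\pi_({ideal_quot I}))) phiE rmorph1.
  by move=> x y; rewrite -[x]reprK -[y]reprK -rmorphM !phiE rmorphM.
pose Phi : {rmorphism {ideal_quot I} -> B} := HB.pack phi
  (GRing.isZmodMorphism.Build _ _ phi phiB) (GRing.isMonoidMorphism.Build _ _ phi phiM).
exists Phi; split; last exact: phiE.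
move=> x y /= /eqP; rewrite -subr_eq0 -rmorphB => fxy.
rewrite -[x]reprK -[y]reprK; apply/eqP.
by rewrite -Quotient.idealrBE.
Qed.

(** * Comparisons in a totally ordered group *)

Section OrderedGroup.
Variable G : orderedAbGroupType.
Implicit Types g h z : G.

Lemma oag_leNgt g h : ~~ (g <= h) = (h < g).
Proof.
apply/idP/idP => [ngh|]; last by move=> hg; apply/negP => /(lt_le_trans hg); rewrite ltxx.
rewrite lt_neqAle; case/orP: (oag_le_total g h) => [gh|->]; first by rewrite gh in ngh.
by rewrite andbT; apply: contraNneq ngh => ->.
Qed.

Lemma oag_ltNge g h : ~~ (g < h) = (h <= g).
Proof. by rewrite -oag_leNgt negbK. Qed.

Lemma oag_ltr_leD g1 g2 h1 h2 : g1 < h1 -> g2 <= h2 -> g1 + g2 < h1 + h2.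
Proof. by move=> l1 l2; rewrite addrC [h1 + _]addrC oag_ler_ltD. Qed.

Lemma oag_lerD2rE z g h : (g + z <= h + z) = (g <= h).
Proof.
apply/idP/idP => [l|]; last exact: oag_lerD2r.
by have := oag_lerD2r (- z) _ _ l; rewrite !addrK.
Qed.

End OrderedGroup.

(** * Power series *)

Section PowerSeriesLemmas.
Variables (N : nat) (k : comNzRingType).
Implicit Types (f g h : {fps k[N]}) (p q : 'X_{1..N}) (c : k).

Lemma fpsP f g : (forall p, f p = g p) -> f = g. Proof. exact: funext. Qed.

Lemma fps0E p : (0 : {fps k[N]}) p = 0. Proof. by []. Qed.
Lemma fpsDE f g p : (f + g) p = f p + g p. Proof. by []. Qed.
Lemma fpsNE f p : (- f) p = - f p. Proof. by []. Qed.
Lemma fpsBE f g p : (f - g) p = f p - g p. Proof. by []. Qed.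
Lemma fpsME f g p : (f * g) p =
  \sum_(q : 'X_{1..N < (mdeg p).+1} | (q <= p)%MM) f q * g (p - q)%MM.
Proof. by []. Qed.

Lemma fps_sumE (I : Type) (r : seq I) (P : pred I) (F : I -> {fps k[N]}) p :
  (\sum_(i <- r | P i) F i) p = \sum_(i <- r | P i) F i p.
Proof. by elim/big_rec2: _ => // i y1 y2 _ <-. Qed.

Lemma fps_mul_neq0 f g p : (f * g) p != 0 ->
  exists q r, [/\ f q != 0, g r != 0 & (q + r)%MM = p].
Proof.
rewrite fpsME => /eqP ne0; apply: contrapT => nex; apply: ne0.
apply: big1 => q qp; apply/eqP; apply: contraT => ne.
case: nex; exists (val q), (p - q)%MM; split; last by rewrite addmC submK.
  by apply: contraNneq ne => ->; rewrite mul0r.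
by apply: contraNneq ne => ->; rewrite mulr0.
Qed.

Lemma fps_constM c f p : (fps_const c * f) p = c * f p.
Proof.
have hT q : (mdeg q <= mdeg p)%N -> (fps_trunc (mdeg p).+1 f)@_q = f q.
  by move=> lq; apply: fps_truncE; rewrite ltnS.
by rewrite [LHS](fps_mulE (fun q _ => fps_constE c q) hT) mcoeffCM hT.
Qed.

Lemma fps_monomM q f p :
  (fps_monom k q * f) p = if (q <= p)%MM then f (p - q)%MM else 0.
Proof.
case: ifPn => [qp|nqp]; last first.
  apply/eqP; apply: contraNT nqp => /fps_mul_neq0 [q' [r []]]; rewrite /fps_monom.
  by have [-> _ _ <-|_] := eqVneq q' q; rewrite ?eqxx ?lem_addr.
have dq : (mdeg q < (mdeg p).+1)%N by rewrite ltnS -(submK qp) mdegD leq_addl.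
rewrite fpsME (bigD1 (BMultinom dq)) //= big1 ?addr0; last first.
  move=> r /andP[_ ne]; rewrite /fps_monom; case: eqP => [e|]; last by rewrite mul0r.
  by rewrite bmeqP e eqxx in ne.
by rewrite /fps_monom eqxx mul1r.
Qed.

Lemma fps_monom_neq0 q p : fps_monom k q p != 0 -> p = q.
Proof. by rewrite /fps_monom; case: (eqVneq p q) => // _; rewrite eqxx. Qed.

Lemma fps_monomD p q : fps_monom k (p + q)%MM = fps_monom k p * fps_monom k q.
Proof.
apply: fpsP => r; rewrite fps_monomM /fps_monom; case: ifPn => [pr|npr].
  congr ((_ : bool)%:R); apply/eqP/eqP => [->|<-]; first by rewrite addmC addmK.
  by rewrite addmC submK.
by case: eqP npr => // ->; rewrite lem_addr.
Qed.

Lemma fps_monom0 : fps_monom k 0%MM = 1 :> {fps k[N]}.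
Proof. by apply: fpsP => p; rewrite /fps_monom /GRing.one /= /fps_const; case: eqP. Qed.

Definition fps_of_mpoly (P : {mpoly k[N]}) : {fps k[N]} := fun p => P@_p.

Lemma fps_of_mpoly_is_zmod_morphism : zmod_morphism fps_of_mpoly.
Proof. by move=> P Q; apply: fpsP => p; rewrite /fps_of_mpoly mcoeffB. Qed.

Lemma fps_of_mpoly_is_monoid_morphism : monoid_morphism fps_of_mpoly.
Proof.
split.
  by apply: fpsP => p; rewrite /fps_of_mpoly mcoeff1 /GRing.one /= /fps_const; case: eqP.
by move=> P Q; apply: fpsP => p; rewrite [RHS](@fps_mulE _ _ _ _ _ P Q).
Qed.

HB.instance Definition _ := GRing.isZmodMorphism.Build _ _ fps_of_mpoly
  fps_of_mpoly_is_zmod_morphism.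
HB.instance Definition _ := GRing.isMonoidMorphism.Build _ _ fps_of_mpoly
  fps_of_mpoly_is_monoid_morphism.

Lemma fps_of_mpolyC c : fps_of_mpoly c%:MP = fps_const c.
Proof. by apply: fpsP => p; rewrite /fps_of_mpoly fps_constE. Qed.

Lemma fps_of_mpolyX q : fps_of_mpoly 'X_[q] = fps_monom k q.
Proof. by apply: fpsP => p; rewrite /fps_of_mpoly mcoeffX /fps_monom eq_sym. Qed.

Lemma fps_of_mpolyZ c P : fps_of_mpoly (c *: P) = fps_const c * fps_of_mpoly P.
Proof. by rewrite -mul_mpolyC rmorphM /= fps_of_mpolyC. Qed.

Lemma fps_of_binom c p q :
  fps_of_mpoly ('X_[p] - c *: 'X_[q]) = fps_binom c p q.
Proof. by rewrite rmorphB /= fps_of_mpolyZ !fps_of_mpolyX. Qed.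

(* A monomial ideal containing [f] has finitely many monomial generators, so
   [f] is a combination of finitely many of the monomials with series as
   coefficients. *)
Lemma fps_monomial_ideal (I : set {fps k[N]}) f : is_ideal I ->
  (forall p, f p != 0 -> I (fps_monom k p)) -> I f.
Proof.
move=> idI hI.
have [s sA sf] := dickson (fun (p : 'X_{1..N}) i => p i) [set p | f p != 0].
have {hI sA} : forall q, q \in s -> I (fps_monom k q) by move=> q /sA /hI.
have {sf} : forall p, f p != 0 -> exists2 q, q \in s & (q <= p)%MM.
  by move=> p /sf[q qs qp]; exists q => //; apply/mnm_lepP.
elim: s f => [|q s IH] f fs Is.
  rewrite (_ : f = 0); first exact: ideal_zero.
  by apply: fpsP => p; apply/eqP; apply: contraT => /fs[].
(* Split off the terms divisible by u^q; those left over are divisible by another generator. *)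
pose f1 : {fps k[N]} := fun p => f (p + q)%MM.
pose f2 : {fps k[N]} := fun p => if (q <= p)%MM then 0 else f p.
have -> : f = fps_monom k q * f1 + f2.
  apply: fpsP => p; rewrite fpsDE fps_monomM /f1 /f2.
  by case: ifP => qp; rewrite ?add0r // submK // addr0.
apply: ideal_add => //; first by apply: ideal_mulr => //; apply: Is; rewrite mem_head.
apply: IH => [p|q' q's]; last by apply: Is; rewrite inE q's orbT.
rewrite /f2; case: ifP => [|nqp]; first by rewrite eqxx.
move=> /fs[q']; rewrite inE => /predU1P[->|q's q'p]; first by rewrite nqp.
by exists q'.
Qed.

End PowerSeriesLemmas.

(** * Evaluation of power series in a complete ring *)

Section Evaluation.
Variables (N : nat) (k R : comNzRingType) (m : set R).
Variables (iota : {rmorphism k -> R}) (xi : 'I_N -> R).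
Hypothesis (m_complete : adic_complete m).
Hypothesis (xi_m : forall i, m (xi i)).

Local Notation ev := (mmap iota xi).
Local Notation "'m^' n" := (ideal_pow m n) (at level 2).
Let id_pow n : is_ideal (ideal_pow m n) := ideal_pow_ideal m n.

Lemma mmap_ideal_pow n (P : {mpoly k[N]}) :
  (forall p, (mdeg p < n)%N -> P@_p = 0) -> m^ n (ev P).
Proof.
move=> hP; rewrite /mmap big_seq; apply: ideal_sum => // p.
rewrite mcoeff_msupp => Pp; apply: ideal_mull => //.
apply: (@ideal_powW _ _ _ (mdeg p)); last exact: mmap1_ideal_pow.
by rewrite leqNgt; apply: contra_neqN Pp => /hP ->.
Qed.

(** The values of the truncations form a Cauchy sequence, whose limit defines [phi f]. Separatedness
    makes the limit unique, so every identity is checked modulo each power of [m]. *)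
Lemma fps_eval_exists : exists phi : {rmorphism {fps k[N]} -> R},
  forall P, phi (fps_of_mpoly P) = ev P.
Proof.
pose u (f : {fps k[N]}) n := ev (fps_trunc n f).
have uu f n i : (n <= i)%N -> m^ n (u f i - u f n).
  move=> ni; rewrite -rmorphB; apply: mmap_ideal_pow => p pn.
  by rewrite mcoeffB !fps_truncE ?subrr // (leq_trans pn).
case: m_complete => sep complete.
have eqR x y : (forall n, m^ n (x - y)) -> x = y.
  by move=> h; apply/eqP; rewrite -subr_eq0; apply/eqP/sep.
have limit f : exists l, forall n, m^ n (l - u f n).
  case: (complete (u f)) => [n|l hl].
    exists n => i j ni nj; rewrite -(subrK (u f n) (u f i)) -addrA.
    by apply: ideal_add (uu _ _ _ ni) _ => //; rewrite -opprB; apply: ideal_opp => //; exact: uu.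
  exists l => n; have [M hM] := hl n.
  rewrite -(subrK (u f (maxn M n)) l) -addrA; apply: ideal_add => //.
    by rewrite -opprB; apply: ideal_opp => //; apply: hM; exact: leq_maxl.
  exact: uu (leq_maxr _ _).
have [phi hphi] := choice limit.
have phi_eq f y : (forall n, m^ n (y - u f n)) -> phi f = y.
  move=> h; apply: eqR => n; rewrite -(subrK (u f n) (phi f)) -addrA.
  by apply: ideal_add => //; rewrite -opprB; exact: ideal_opp.
have phiB : zmod_morphism phi.
  move=> f g; apply: phi_eq => n.
  rewrite (_ : u (f - g) n = u f n - u g n); last first.
    rewrite /u -rmorphB; congr ev; rewrite /fps_trunc -sumrB.
    by apply: eq_bigr => p _; rewrite -scalerBl.
  by rewrite opprD addrACA -opprD; exact: ideal_sub.
have phiP P : phi (fps_of_mpoly P) = ev P.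
  apply: phi_eq => n; rewrite /u -rmorphB; apply: mmap_ideal_pow => p pn.
  by rewrite mcoeffB fps_truncE // subrr.
have phiM : monoid_morphism phi.
  split; first by rewrite -(rmorph1 (@fps_of_mpoly N k)) phiP rmorph1.
  move=> f g; apply: phi_eq => n.
  pose T := fps_trunc n (N := N) (k := k).
  (* The first two terms lie in the n-th power by approximation, the third because the two
     polynomials agree in degrees below [n]. *)
  have -> : phi f * phi g - u (f * g) n = phi f * (phi g - u g n)
     + (phi f - u f n) * u g n + ev (T f * T g - T (f * g)).
    by rewrite rmorphB rmorphM mulrBr mulrBl !addrA !subrK.
  apply: ideal_add => //; first apply: ideal_add => //.
  - exact: ideal_mull.
  - exact: ideal_mulr.
  apply: mmap_ideal_pow => p pn; rewrite mcoeffB fps_truncE //.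
  rewrite -[(f * g) p]/(fps_mul f g p) (@fps_mulE _ _ _ _ _ (T f) (T g)) ?subrr // => q qp;
    by rewrite fps_truncE // (leq_ltn_trans qp).
exists (HB.pack phi (GRing.isZmodMorphism.Build _ _ phi phiB)
  (GRing.isMonoidMorphism.Build _ _ phi phiM) : {rmorphism {fps k[N]} -> R}).
exact: phiP.
Qed.

End Evaluation.

(** * Weights *)

Section Weight.
Variables (N : nat) (G : orderedAbGroupType) (w : {additive 'rV[int]_N -> G}).
Implicit Types p q : 'X_{1..N}.

Lemma expvecD p q : expvec (p + q)%MM = expvec p + expvec q.
Proof. by apply/rowP => i; rewrite !mxE mnmDE PoszD. Qed.

Lemma wtD p q : wt w (p + q)%MM = wt w p + wt w q.
Proof. by rewrite /wt expvecD raddfD. Qed.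

Lemma wt0 : wt w 0%MM = 0.
Proof. by apply: (@addrI _ (wt w 0%MM)); rewrite -wtD addm0 addr0. Qed.

Hypothesis w_gt0 : forall i, 0 < wt w U_(i)%MM.

Lemma mnm_neq0 p : p != 0%MM -> exists i, (U_(i) <= p)%MM.
Proof.
move=> p0; have [i pi] : exists i, p i != 0%N.
  apply: contrapT => nex; case/eqP: p0; apply/mnmP => i; rewrite mnm0E.
  by apply/eqP; apply: contraT => pi; case: nex; exists i.
by exists i; rewrite lep1mP.
Qed.

Lemma mnm_ind (P : 'X_{1..N} -> Prop) :
  P 0%MM -> (forall i p, P p -> P (p + U_(i))%MM) -> forall p, P p.
Proof.
move=> P0 PD p; have [d] := ubnP (mdeg p); elim: d p => // d IH p; rewrite ltnS => pd.
have [->//|p0] := eqVneq p 0%MM.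
have [i pi] := mnm_neq0 p0.
rewrite -(submK pi); apply/PD/IH.
by apply: leq_trans pd; rewrite -{2}(submK pi) mdegD mdeg1 addn1.
Qed.

Lemma wt_ge0 p : 0 <= wt w p.
Proof.
elim/mnm_ind: p => [|i p IH]; first by rewrite wt0.
by rewrite wtD -[0]addr0 oag_lerD // ltW.
Qed.

Lemma wt_gt0 p : p != 0%MM -> 0 < wt w p.
Proof.
move=> p0; have [i pi] := mnm_neq0 p0.
by rewrite -(submK pi) wtD -[0]addr0 oag_ler_ltD ?wt_ge0.
Qed.

Lemma wt_le p q : (p <= q)%MM -> wt w p <= wt w q.
Proof. by move=> pq; rewrite -(submK pq) wtD -{1}[wt w p]add0r oag_lerD ?wt_ge0. Qed.

Lemma wt_lt p q : (p <= q)%MM -> p != q -> wt w p < wt w q.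
Proof.
move=> pq npq; rewrite -(submK pq) wtD -{1}[wt w p]add0r oag_ltr_leD ?wt_gt0 //.
by apply: contraNneq npq => e; rewrite -(submK pq) e add0m.
Qed.

(** Weights increase along divisibility, so the minimum over [A] is attained on the finite set given
    by Dickson's lemma. Hence the weights are well-ordered, whatever the rank of [G]. *)
Lemma wt_min (A : set 'X_{1..N}) : (exists p, A p) ->
  exists2 p, A p & forall q, A q -> wt w p <= wt w q.
Proof.
move=> [p0 Ap0]; have [s sA hs] := dickson (fun (p : 'X_{1..N}) i => p i) A.
have [q0 q0s _] := hs _ Ap0.
have [p ps pmin] : exists2 p, p \in s & forall q, q \in s -> wt w p <= wt w q.
  elim: s q0 q0s {sA hs} => // r s IH _ _.
  have [s0|[q qs]] : s = [::] \/ exists q, q \in s.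
    by case: (s) => [|q s']; [left|right; exists q; rewrite mem_head].
    by exists r => [|q]; rewrite s0 inE // => /eqP ->.
  have [p ps pmin] := IH q qs.
  case/orP: (oag_le_total (wt w r) (wt w p)) => l.
    exists r => [|t]; rewrite inE ?eqxx // => /predU1P[->//|/pmin]; exact: le_trans.
  by exists p => [|t]; rewrite inE ?ps ?orbT // => /predU1P[->//|/pmin].
exists p; first exact: sA.
by move=> q /hs[r rs /mnm_lepP rq]; apply: le_trans (pmin _ rs) (wt_le rq).
Qed.

Lemma wt_ind (P : G -> Prop) :
  (forall p, (forall q, wt w q < wt w p -> P (wt w q)) -> P (wt w p)) ->
  forall p, P (wt w p).
Proof.
move=> IH p; apply: contrapT => nPp.
have [q nPq qmin] := wt_min (ex_intro (fun p => ~ P (wt w p)) p nPp).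
apply: nPq; apply: IH => r rq; apply: contrapT => /qmin.
by move=> /(lt_le_trans rq); rewrite ltxx.
Qed.

(** Only weights count as predecessors, since the order of [G] itself need not be well-founded. *)
Definition wt_lt_rel (h g : G) := (exists p, wt w p = h) /\ h < g.

Lemma wt_lt_rel_wf : well_founded wt_lt_rel.
Proof.
have accp : forall p, Acc wt_lt_rel (wt w p).
  by apply: wt_ind => p IH; constructor => _ [[q <-]]; exact: IH.
by move=> g; constructor => _ [[q <-] _].
Qed.

(** Weights strictly increase along divisibility, so exponents of equal weight are pairwise
    incomparable and Dickson's finite set is the whole fibre. *)
Lemma wt_finite g : exists2 s : seq 'X_{1..N}, uniq s & forall p, (p \in s) = (wt w p == g).
Proof.
have [s sA hs] := dickson (fun (p : 'X_{1..N}) i => p i) [set p | wt w p = g].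
exists (undup s); first exact: undup_uniq.
move=> p; rewrite mem_undup; apply/idP/eqP => [/sA //|pg].
have [q qs /mnm_lepP qp] := hs _ pg.
have [<-//|npq] := eqVneq q p.
by have := wt_lt qp npq; rewrite (sA _ qs) pg ltxx.
Qed.

(** * Homogeneous components of series *)

Section Components.
Variable k : comNzRingType.
Implicit Types f h : {fps k[N]}.

Definition wt_supp_ge (g : G) f := forall p, f p != 0 -> g <= wt w p.
Definition wt_supp_gt (g : G) f := forall p, f p != 0 -> g < wt w p.
Definition wt_homog (g : G) f := forall p, f p != 0 -> wt w p = g.

Definition wt_comp (g : G) f : {fps k[N]} := fun p => if wt w p == g then f p else 0.
Definition wt_tail (g : G) f : {fps k[N]} := fun p => if g <= wt w p then f p else 0.

Lemma fpsD_neq0 f h p : (f + h) p != 0 -> f p != 0 \/ h p != 0.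
Proof.
rewrite fpsDE; have [->|] := eqVneq (f p) 0; last by left.
by rewrite add0r; right.
Qed.

Lemma fpsN_neq0 f p : (- f) p != 0 -> f p != 0.
Proof. by rewrite fpsNE oppr_eq0. Qed.

Lemma fps_sum_neq0 (I : Type) (r : seq I) (F : I -> {fps k[N]}) p :
  (\sum_(i <- r) F i) p != 0 -> exists i, F i p != 0.
Proof.
elim: r => [|i r IH]; first by rewrite big_nil fps0E eqxx.
by rewrite big_cons => /fpsD_neq0[|/IH //]; exists i.
Qed.

Lemma wt_supp_gtW g f : wt_supp_gt g f -> wt_supp_ge g f.
Proof. by move=> h p /h /ltW. Qed.

Lemma wt_supp_gtD g f h : wt_supp_gt g f -> wt_supp_gt g h -> wt_supp_gt g (f + h).
Proof. by move=> hf hh p /fpsD_neq0[/hf|/hh]. Qed.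

Lemma wt_supp_gtN g f : wt_supp_gt g f -> wt_supp_gt g (- f).
Proof. by move=> hf p /fpsN_neq0/hf. Qed.

Lemma wt_supp_geD g f h : wt_supp_ge g f -> wt_supp_ge g h -> wt_supp_ge g (f + h).
Proof. by move=> hf hh p /fpsD_neq0[/hf|/hh]. Qed.

Lemma wt_supp_gt_sum g (I : Type) (r : seq I) (F : I -> {fps k[N]}) :
  (forall i, wt_supp_gt g (F i)) -> wt_supp_gt g (\sum_(i <- r) F i).
Proof. by move=> hF p /fps_sum_neq0[i /hF]. Qed.

Lemma wt_supp_ge_gtM g1 g2 f h : wt_supp_ge g1 f -> wt_supp_gt g2 h ->
  wt_supp_gt (g1 + g2) (f * h).
Proof.
move=> hf hh p /fps_mul_neq0[q [r [/hf l1 /hh l2 <-]]].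
by rewrite wtD oag_ler_ltD.
Qed.

Lemma wt_supp_geM g1 g2 f h : wt_supp_ge g1 f -> wt_supp_ge g2 h ->
  wt_supp_ge (g1 + g2) (f * h).
Proof.
move=> hf hh p /fps_mul_neq0[q [r [/hf l1 /hh l2 <-]]].
by rewrite wtD oag_lerD.
Qed.

Lemma wt_homog_ge g f : wt_homog g f -> wt_supp_ge g f.
Proof. by move=> hf p /hf ->. Qed.

Lemma wt_comp_homog g f : wt_homog g (wt_comp g f).
Proof. by move=> p; rewrite /wt_comp; case: (wt w p =P g) => //; rewrite eqxx. Qed.

Lemma wt_comp_id g f : wt_homog g f -> wt_comp g f = f.
Proof.
move=> hf; apply: fpsP => p; rewrite /wt_comp; case: (wt w p =P g) => // ne.
by apply/esym/eqP; apply: contraT => /hf.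
Qed.

Lemma wt_comp_neq g1 g2 f : wt_homog g2 f -> g1 != g2 -> wt_comp g1 f = 0.
Proof.
move=> hf ne; apply: fpsP => p; rewrite /wt_comp; case: (wt w p =P g1) => // e.
by apply/eqP; apply: contraT => /hf; rewrite e => e'; rewrite e' eqxx in ne.
Qed.

Lemma wt_compD g f h : wt_comp g (f + h) = wt_comp g f + wt_comp g h.
Proof. by apply: fpsP => p; rewrite fpsDE /wt_comp; case: ifP; rewrite ?addr0. Qed.

Lemma wt_comp0 g : wt_comp g 0 = 0.
Proof. by apply: fpsP => p; rewrite /wt_comp; case: ifP. Qed.

Lemma wt_tail_ge g f : wt_supp_ge g (wt_tail g f).
Proof. by move=> p; rewrite /wt_tail; case: ifP => //; rewrite eqxx. Qed.

Lemma wt_supp_ge_comp g f : wt_supp_ge g f -> wt_supp_gt g (f - wt_comp g f).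
Proof.
move=> hf p; rewrite fpsBE /wt_comp; have [_|ne] := eqVneq (wt w p) g.
  by rewrite subrr eqxx.
by rewrite subr0 => /hf l; rewrite lt_neqAle l eq_sym ne.
Qed.

(** Only finitely many exponents have weight [g]. *)
Lemma wt_comp_mpoly g f : exists2 P : {mpoly k[N]}, wt_comp g f = fps_of_mpoly P &
  forall p, p \in msupp P -> wt w p = g.
Proof.
have [s us hs] := wt_finite g.
exists (\sum_(p <- s) f p *: 'X_[p]); last first.
  move=> p /msupp_sum_le /flattenP[l /mapP[q]]; rewrite mem_filter /= => qs ->.
  move/msuppZ_le; rewrite msuppX inE => /eqP ->.
  by apply/eqP; rewrite -hs.
apply: fpsP => p; rewrite /fps_of_mpoly raddf_sum /= /wt_comp -hs.
rewrite (eq_bigr (fun q => if q == p then f p else 0)) => [|q _]; last first.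
  by rewrite mcoeffZ mcoeffX; case: eqP => [->|]; rewrite ?mulr1 ?mulr0.
case: ifP => ps; last first.
  by rewrite big_seq big1 // => q qs; case: eqP => // e; rewrite e ps in qs.
rewrite (bigD1_seq p) //= eqxx big1 ?addr0 // => q; by case: (q =P p).
Qed.

End Components.
End Weight.

(** * Values *)

Section ValuationIdeals.
Variables (R : idomainType) (G : orderedAbGroupType).
Variable v : valuation {fraction R} G.
Implicit Types (x y : R) (g : G).

Definition ring_ge g x := val_ge v g x%:F.
Definition ring_gt g x := val_gt v g x%:F.

Local Notation vge := ring_ge.
Local Notation vgt := ring_gt.

Lemma vge_trans g h x : g <= h -> vge h x -> vge g x.
Proof. by move=> gh /orP[e|/(le_trans gh) l]; apply/orP; [left|right]. Qed.

Lemma vge_gt_trans g h x : g < h -> vge h x -> vgt g x.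
Proof. by move=> gh /orP[e|/(lt_le_trans gh) l]; apply/orP; [left|right]. Qed.

Lemma tofrac_neq0 x : x != 0 -> x%:F != 0.
Proof. by rewrite tofrac_eq0. Qed.

Lemma vgtD g x y : vgt g x -> vgt g y -> vgt g (x + y).
Proof. by rewrite /ring_gt tofracD; exact: val_gtD. Qed.

Lemma vgtN g x : vgt g x -> vgt g (- x).
Proof. by rewrite /ring_gt tofracN; exact: val_gtN. Qed.

Lemma vgtB g x y : vgt g x -> vgt g y -> vgt g (x - y).
Proof. by move=> hx /vgtN; exact: vgtD. Qed.

Lemma vgeM_gt g1 g2 x y : vge g1 x -> vgt g2 y -> vgt (g1 + g2) (x * y).
Proof. by rewrite /ring_ge /ring_gt tofracM; exact: val_ge_gtM. Qed.

Lemma vge_exact g x : vge g x -> ~~ vgt g x -> x != 0 /\ v x%:F = g.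
Proof.
rewrite /ring_ge /ring_gt /val_ge /val_gt tofrac_eq0; case: (x =P 0) => //= _ le.
by rewrite oag_ltNge => ge; split=> //; apply/eqP; rewrite eq_le le ge.
Qed.

Lemma exact_vge g x : v x%:F = g -> vge g x.
Proof. by move=> <-; rewrite /ring_ge /val_ge lexx orbT. Qed.

Lemma exact_vgt g x : x != 0 -> v x%:F = g -> ~~ vgt g x.
Proof. by move=> x0 <-; rewrite /ring_gt /val_gt ltxx tofrac_eq0 orbF. Qed.

Section Dominated.
Variables (m : set R) (v_dom : dominates v m).

Lemma vge0 x : vge 0 x. Proof. exact: v_dom.1. Qed.

Lemma vge_ideal g : is_ideal (vge g).
Proof.
split=> [|x y|a x hx]; first by rewrite /ring_ge tofrac0 val_ge0.
  by rewrite /ring_ge tofracD; exact: val_geD.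
by rewrite /ring_ge tofracM -[g]add0r; apply: val_geM hx; exact: vge0.
Qed.

Lemma vgt_ideal g : is_ideal (vgt g).
Proof.
split=> [|x y|a x hx]; first by rewrite /ring_gt tofrac0 val_gt0.
  exact: vgtD.
by rewrite /ring_gt tofracM -[g]add0r; apply: val_ge_gtM hx; exact: vge0.
Qed.

(** A nonzero constant is a unit, and 1 does not have positive value. *)
Lemma field_vgt0 (k : fieldType) (iota : {rmorphism k -> R}) c :
  vgt 0 (iota c) -> c = 0.
Proof.
move=> hc; apply/eqP; apply: contraT => c0.
have : vgt 0 (iota c^-1 * iota c).
  exact: (ideal_mull (vgt_ideal 0)).
rewrite -rmorphM mulVf // rmorph1 /ring_gt /val_gt tofrac1 val_fun1 ltxx orbF.
by rewrite oner_eq0.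
Qed.

Lemma field_val (k : fieldType) (iota : {rmorphism k -> R}) c :
  c != 0 -> v (iota c)%:F = 0.
Proof.
move=> c0; apply: (vge_exact (vge0 _) _).2.
by apply: contra_neqN c0; exact: field_vgt0.
Qed.

End Dominated.
End ValuationIdeals.

(** * Homogeneous series *)

Section HomogeneousLemmas.
Variables (N : nat) (G : orderedAbGroupType) (w : {additive 'rV[int]_N -> G}).
Variable k : comNzRingType.
Implicit Types (f h : {fps k[N]}) (g : G).

Lemma wt_homog0 g : wt_homog w g (0 : {fps k[N]}).
Proof. by move=> p; rewrite fps0E eqxx. Qed.

Lemma wt_homogD g f h : wt_homog w g f -> wt_homog w g h -> wt_homog w g (f + h).
Proof. by move=> hf hh p /fpsD_neq0[/hf|/hh]. Qed.

Lemma wt_homogM g1 g2 f h : wt_homog w g1 f -> wt_homog w g2 h ->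
  wt_homog w (g1 + g2) (f * h).
Proof.
move=> hf hh p /fps_mul_neq0[q [r [/hf <- /hh <- <-]]].
by rewrite wtD.
Qed.

Lemma wt_homog_monom p : wt_homog w (wt w p) (fps_monom k p).
Proof. by move=> q /fps_monom_neq0 ->. Qed.

Lemma wt_homog_const c : wt_homog w 0 (fps_const c : {fps k[N]}).
Proof. by move=> p; rewrite /fps_const; case: (p =P _) => [->|]; rewrite ?eqxx ?wt0. Qed.

End HomogeneousLemmas.

(** * Binomial relations *)

Section BinomialCombinations.
Variables (N : nat) (G : orderedAbGroupType) (w : {additive 'rV[int]_N -> G}).
Variables (k : fieldType) (s : nat) (a b : 'I_s -> 'X_{1..N}) (c : 'I_s -> k).
Implicit Types (P Q : {mpoly k[N]}) (g : G).

(** The degree [g] part of the binomial ideal. Homogeneity of the coefficients is recorded because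
    the same coefficients are later applied to the deformed binomials, where it controls the
    weights. *)
Definition binom_comb g P := exists2 h : 'I_s -> {mpoly k[N]},
  P = \sum_l h l * ('X_[a l] - c l *: 'X_[b l]) &
  forall l, wt_homog w (g - wt w (a l)) (fps_of_mpoly (h l)).

Lemma binom_comb0 g : binom_comb g 0.
Proof.
exists (fun=> 0) => [|l]; first by rewrite big1 // => l _; rewrite mul0r.
by rewrite rmorph0; exact: wt_homog0.
Qed.

Lemma binom_combD g P Q : binom_comb g P -> binom_comb g Q -> binom_comb g (P + Q).
Proof.
move=> [h -> hh] [h' -> hh']; exists (fun l => h l + h' l) => [|l].
  by rewrite -big_split; apply: eq_bigr => l _; rewrite mulrDl.
by rewrite rmorphD; exact: wt_homogD.
Qed.

Lemma binom_combM g1 g2 P Q : wt_homog w g1 (fps_of_mpoly P) ->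
  binom_comb g2 Q -> binom_comb (g1 + g2) (P * Q).
Proof.
move=> hP [h -> hh]; exists (fun l => P * h l) => [|l].
  by rewrite mulr_sumr; apply: eq_bigr => l _; rewrite mulrA.
by rewrite rmorphM -addrA; exact: wt_homogM.
Qed.

Lemma binom_combZ g e P : binom_comb g P -> binom_comb g (e *: P).
Proof.
move=> hP; rewrite -mul_mpolyC -[g]add0r; apply: binom_combM hP.
by rewrite fps_of_mpolyC; exact: wt_homog_const.
Qed.

Lemma binom_comb_gen l : binom_comb (wt w (a l)) ('X_[a l] - c l *: 'X_[b l]).
Proof.
exists (fun l' => (l' == l)%:R) => [|l'].
  rewrite (bigD1 l) //= eqxx mul1r big1 ?addr0 // => l' /negbTE ->.
  by rewrite mul0r.
case: (l' =P l) => [->|_]; last by rewrite rmorph0; exact: wt_homog0.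
by rewrite subrr rmorph1; exact: wt_homog_const.
Qed.

(** Equivalently, modulo the binomials each graded piece is spanned by any single monomial in it. *)
Definition binoms_generate :=
  forall p q, wt w p = wt w q -> exists e, binom_comb (wt w p) ('X_[p] - e *: 'X_[q]).

Lemma binom_comb_reduce q P : binoms_generate ->
  (forall p, p \in msupp P -> wt w p = wt w q) ->
  exists e, binom_comb (wt w q) (P - e *: 'X_[q]).
Proof.
move=> gen hP; rewrite (mpolyE P); elim: (msupp P) hP => [|p r IH] hr.
  by exists 0; rewrite big_nil scale0r subr0; exact: binom_comb0.
have [e he] : exists e, binom_comb (wt w q) (\sum_(p <- r) P@_p *: 'X_[p] - e *: 'X_[q]).
  by apply: IH => p' p'r; apply: hr; rewrite inE p'r orbT.
have pq := hr _ (mem_head _ _).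
have [e' he'] := gen _ _ pq; rewrite pq in he'.
exists (P@_p * e' + e); rewrite big_cons scalerDl opprD addrACA -scalerA -scalerBr.
by apply: binom_combD he; exact: binom_combZ.
Qed.

End BinomialCombinations.

(** * Components of a product *)

Section ComponentProduct.
Variables (N : nat) (G : orderedAbGroupType) (w : {additive 'rV[int]_N -> G}).
Variable k : comNzRingType.
Hypothesis w_gt0 : forall i, 0 < wt w U_(i)%MM.
Implicit Types (f h : {fps k[N]}) (g : G).

Lemma wt_comp_mul g f h : exists L : seq G,
  wt_comp w g (f * h) = \sum_(z <- L) wt_comp w z f * wt_comp w (g - z) h.
Proof.
have [s us hs] := wt_finite w_gt0 g.
(* [d] exceeds the degree of every exponent of weight [g], hence of every divisor of one; this makes
   the sum over [z] finite. *)
pose d := (\max_(p <- s) mdeg p).+1.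
exists (undup [seq wt w (bmnm q) | q : 'X_{1..N < d}]); set L := undup _.
apply: fpsP => p; rewrite fps_sumE /wt_comp.
case: (wt w p =P g) => [pg|npg]; last first.
  apply/esym; apply: big1 => z _; apply/eqP; apply: contraT => ne.
  case: npg; rewrite -[g](subrK z) addrC.
  by apply: (wt_homogM _ _ ne); exact: wt_comp_homog.
under [RHS]eq_bigr do rewrite fpsME.
rewrite exchange_big fpsME; apply: eq_bigr => q qp /=.
have qL : wt w q \in L.
  rewrite mem_undup; apply/mapP.
  have qd : (mdeg q < d)%N.
    apply: leq_trans (bmdeg q) _; rewrite ltnS.
    by apply: (leq_bigmax_seq p) => //; rewrite hs pg.
  by exists (BMultinom qd); rewrite ?mem_enum.
rewrite (bigD1_seq _ qL) ?undup_uniq //= big1 ?addr0 => [|z zq]; last first.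
  by rewrite /wt_comp [_ == z]eq_sym (negbTE zq) mul0r.
have pE : wt w p = wt w (p - q)%MM + wt w q by rewrite -wtD submK.
by rewrite /wt_comp eqxx -pg pE addrK eqxx.
Qed.

End ComponentProduct.

(** * The Rees algebra *)

Section ReesMonomials.
Variables (R : idomainType) (G : orderedAbGroupType) (v : valuation {fraction R} G).

Lemma rees_monom_subproof (g : nneg G) (x : R) :
  ring_ge v g x -> << x *g g >> \in rees_pred v.
Proof.
move=> gx; apply/asboolP => g'; rewrite mcoeffU.
by case: (g =P g') => [<-//|_]; rewrite mulr0n tofrac0 val_ge0.
Qed.

(** The element x t^g of the Rees algebra. *)
Definition rees_monom (g : nneg G) (x : R) (gx : ring_ge v g x) : rees v :=
  Rees (rees_monom_subproof gx).

Variables (m : set R) (v_dom : dominates v m).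

Definition rees_const (x : R) : rees v :=
  rees_monom (g := nneg_zero G) (vge0 v_dom x).

Lemma rees_const_is_zmod_morphism : zmod_morphism rees_const.
Proof. by move=> x y; apply: val_inj; rewrite /= monalgUB. Qed.

Lemma rees_const_is_monoid_morphism : monoid_morphism rees_const.
Proof.
split; first exact: val_inj.
move=> x y; apply: val_inj; rewrite /= malgM_def fgmulUU.
by congr (mkmalgU _ _); apply: val_inj; rewrite /= addr0.
Qed.

HB.instance Definition _ := GRing.isZmodMorphism.Build _ _ rees_const
  rees_const_is_zmod_morphism.
HB.instance Definition _ := GRing.isMonoidMorphism.Build _ _ rees_const
  rees_const_is_monoid_morphism.

End ReesMonomials.

(** * Series representing elements of a valued ring *)

Section WeightedPresentation.
Variables (k : fieldType) (R : idomainType) (m : set R).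
Variables (iota : {rmorphism k -> R}) (G : orderedAbGroupType).
Variables (v : valuation {fraction R} G) (N : nat).
Variables (w : {additive 'rV[int]_N -> G}) (phi : {rmorphism {fps k[N]} -> R}).
Hypotheses (v_dom : dominates v m) (v_rat : rational_valuation v).
Hypothesis k_repr : field_of_representatives m iota.
Hypothesis w_gt0 : forall i, 0 < wt w U_(i)%MM.
Hypothesis v_wt : forall x : R, x != 0 -> exists p, v x%:F = wt w p.
Hypothesis phi_const : forall c, phi (fps_const c) = iota c.
Hypothesis phi_monom : forall p,
  phi (fps_monom k p) != 0 /\ v (phi (fps_monom k p))%:F = wt w p.
Implicit Types (f h : {fps k[N]}) (p q : 'X_{1..N}) (g : G) (x y : R) (e : k).

Local Notation X p := (phi (fps_monom k p)).
Local Notation vge := (ring_ge v).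
Local Notation vgt := (ring_gt v).
Local Notation wt := (wt w).

(** The series whose image has value at least [g] form an ideal, so it suffices that this ideal
    contains the monomials of [f]. *)
Lemma vge_phi g f : wt_supp_ge w g f -> vge g (phi f).
Proof.
move=> hf; apply: (@fps_monomial_ideal _ _ [set f | vge g (phi f)]) => /= [|p /hf l].
  have idg := vge_ideal v_dom g.
  split=> [|f1 f2|a f1] /=; rewrite ?rmorph0 ?rmorphD ?rmorphM;
    [exact: (ideal_zero idg)|exact: (ideal_add idg)|exact: (ideal_mull idg)].
by rewrite /ring_ge /val_ge (phi_monom p).2 l orbT.
Qed.

Lemma vgt_phi g f : wt_supp_gt w g f -> vgt g (phi f).
Proof.
move=> hf; apply: (@fps_monomial_ideal _ _ [set f | vgt g (phi f)]) => /= [|p /hf l].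
  have idg := vgt_ideal v_dom g.
  split=> [|f1 f2|a f1] /=; rewrite ?rmorph0 ?rmorphD ?rmorphM;
    [exact: (ideal_zero idg)|exact: (ideal_add idg)|exact: (ideal_mull idg)].
by rewrite /ring_gt /val_gt (phi_monom p).2 l orbT.
Qed.

Lemma vge_monom p : vge (wt p) (X p).
Proof. by apply: exact_vge; rewrite (phi_monom p).2. Qed.

(** When [y] has value exactly [wt q], its quotient by [X q] has value 0; rationality and the field
    of representatives then give a constant with the same residue. *)
Lemma residue_exists q y : vge (wt q) y -> exists e, vgt (wt q) (y - iota e * X q).
Proof.
move=> hy; have [ny|/(vge_exact hy)[y0 vy]] := boolP (vgt (wt q) y).
  by exists 0; rewrite rmorph0 mul0r subr0.
have [X0 vX] := phi_monom q; have X0' := tofrac_neq0 X0; have y0' := tofrac_neq0 y0.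
pose z := y%:F / (X q)%:F; have zX : y%:F = z * (X q)%:F by rewrite divfK.
have z0 : z != 0 by rewrite mulf_neq0 ?invr_eq0.
have vz : v z = 0.
  by apply: (@addIr _ (wt q)); rewrite add0r -{1}vX -val_funM // -zX vy.
have [x zx] : exists x : R, val_gt v 0 (z - x%:F).
  by apply: v_rat; rewrite /val_ge vz lexx orbT.
have [e [xe _]] := k_repr x; move: xe => /(v_dom.2 _).1 xe.
exists e; have ze : val_gt v 0 (z - (iota e)%:F).
  by have := val_gtD zx xe; rewrite tofracB addrA subrK.
have := val_ge_gtM (vge_monom q) ze.
by rewrite addr0 mulrC mulrBl -zX -tofracM -tofracB.
Qed.

Lemma residue_eq0 q e : vgt (wt q) (iota e * X q) -> e = 0.
Proof.
have [X0 vX] := phi_monom q; have X0' := tofrac_neq0 X0.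
move=> h; apply/eqP; apply: contraT => e0.
have ie0 : iota e != 0 by rewrite fmorph_eq0.
move: h; rewrite /ring_gt /val_gt tofracM mulf_eq0 (negbTE X0') orbF.
rewrite tofrac_eq0 (negbTE ie0) /= val_funM ?tofrac_neq0 //.
by rewrite (field_val v_dom iota e0) vX add0r ltxx.
Qed.

(** The value of a nonzero element is itself a weight, so it cannot exceed all weights. *)
Lemma vgt_all_eq0 x : (forall p, vgt (wt p) x) -> x = 0.
Proof.
move=> h; apply/eqP; apply: contraT => x0; have [p vx] := v_wt x0.
by have := exact_vgt x0 vx; rewrite h.
Qed.

(* Subtract from [x] the monomial with its leading value, then from the
   remainder, and so on transfinitely along the well-ordered set of weights: at
   a limit step the remainder has value at least the limit, because its value
   is a weight and exceeds all the previous ones. *)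
Lemma expansion_exists x g : vge g x ->
  exists2 f, phi f = x & wt_supp_ge w g f.
Proof.
move=> xg.
(* One exponent for each weight suffices, as the residue lemma approximates with any monomial of the
   right weight. *)
pose ref g := xget 0%MM [set p | wt p = g].
have refP p : wt (ref (wt p)) = wt p.
  exact: (@xgetPex _ 0%MM [set q | wt q = wt p] (ex_intro _ p erefl)).
pose res g y := xget 0 [set e | vgt g (y - iota e * X (ref g))].
have resP p y : vge (wt p) y -> vgt (wt p) (y - iota (res (wt p) y) * X (ref (wt p))).
  move=> py; apply: (@xgetPex _ 0 [set e | vgt (wt p) (y - iota e * X (ref (wt p)))]).
  by have := @residue_exists (ref (wt p)) y; rewrite refP; apply.
pose part g (c : G -> k) : {fps k[N]} := fun p =>
  if (p == ref (wt p)) && (wt p < g) then c (wt p) else 0.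
(* The coefficient at [g] is the residue of what remains after all terms of weight below [g] are
   subtracted. *)
have [c cE] : exists c, forall g, c g = res g (x - phi (part g c)).
  apply: (wf_recursion 0 (wt_lt_rel_wf w_gt0)) => h c c' cc'.
  congr (res h (x - phi _)); apply: fpsP => p; rewrite /part.
  by case: ifP => // /andP[_ ph]; apply: cc'; split=> //; exists p.
pose f : {fps k[N]} := fun p => if p == ref (wt p) then c (wt p) else 0.
(* Only the terms up to [wt p] matter, so this applies to the later partial series and to the full
   series [f]. *)
have step p f' : vge (wt p) (x - phi (part (wt p) c)) ->
    (forall q, wt q <= wt p -> f' q = f q) -> vgt (wt p) (x - phi f').
  move=> /resP; rewrite -cE; set e := c (wt p); set r := ref (wt p) => h ff'.
  pose d := f' - part (wt p) c - fps_const e * fps_monom k r.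
  have -> : x - phi f' = x - phi (part (wt p) c) - iota e * X r - phi d.
    rewrite /d !rmorphB rmorphM phi_const.
    by rewrite !opprB addrA subrK addrA subrK.
  apply: vgtB => //; apply: vgt_phi => q; rewrite -oag_leNgt; apply: contraNN => qp.
  rewrite /d !fpsBE fps_constM ff' // /fps_monom /f /part.
  have [qp'|qp'] := boolP (wt q < wt p).
    rewrite andbT; case: (q =P r) qp' => [->|_ _]; first by rewrite /r refP ltxx.
    by rewrite mulr0 subrr subr0.
  have {}qp : wt q = wt p by apply/eqP; rewrite eq_le qp -oag_ltNge.
  rewrite andbF subr0 qp -/r; case: (q =P r) => _; rewrite ?mulr1 ?mulr0 ?subrr //.
have approx p : vge (wt p) (x - phi (part (wt p) c)).
  apply: (wt_ind w_gt0 (P := fun g => vge g (x - phi (part g c)))) => {}p IH.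
  set y := x - _; have [->|y0] := eqVneq y 0; first exact: ideal_zero (vge_ideal v_dom _).
  have [q vy] := v_wt y0; apply: vge_trans (exact_vge vy).
  rewrite -oag_ltNge; apply/negP => qp; have := exact_vgt y0 vy; apply/negP/negPn.
  apply: step (IH _ qp) _ => r rq; rewrite /part /f.
  by rewrite (le_lt_trans rq qp) andbT.
exists f.
  apply/esym/eqP; rewrite -subr_eq0; apply/eqP; apply: vgt_all_eq0 => p.
  exact: step.
(* Below [g] nothing has been subtracted yet, and [x] has larger value, so the residue is 0. *)
have c0 p : wt p < g -> c (wt p) = 0.
  refine (wt_ind w_gt0 (P := fun g1 => g1 < g -> c g1 = 0) _ p) => {}p IH pg.
  have part0 : part (wt p) c = 0.
    apply: fpsP => q; rewrite /part; case: ifP => // /andP[_ qp].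
    by apply: IH => //; exact: lt_trans pg.
  have := approx p; rewrite part0 rmorph0 subr0 => /resP h.
  apply: (@residue_eq0 (ref (wt p))); rewrite refP cE part0 rmorph0 subr0.
  by have := vgtB (vge_gt_trans pg xg) h; rewrite subKr.
move=> p; rewrite /f; case: ifP => _; last by rewrite eqxx.
by rewrite -oag_ltNge; apply: contra_neqN => /c0.
Qed.

(** * Finitely many binomials generating the homogeneous relations *)

(** Dickson's lemma is applied to the pairs of distinct exponents of equal weight. Removing one of
    the finitely many minimal pairs from [(p, q)] lowers the degree of [p], and one induction gives
    both the polynomial relation and the lattice relation. *)
Lemma binomials_exist : exists (s : nat) (a b : 'I_s -> 'X_{1..N}) (c : 'I_s -> k),
  [/\ forall l, [/\ wt (a l) = wt (b l), a l != b l, c l != 0 &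
        vgt (wt (a l)) (X (a l) - iota (c l) * X (b l))],
      binoms_generate w a b c &
      forall p q, wt p = wt q ->
        exists d : 'I_s -> int,
          expvec p - expvec q = \sum_l (expvec (a l) - expvec (b l)) *~ d l].
Proof.
pose E := [set pq : 'X_{1..N} * 'X_{1..N} | wt pq.1 = wt pq.2 /\ pq.1 != pq.2].
pose coord (pq : 'X_{1..N} * 'X_{1..N}) (i : 'I_N + 'I_N) :=
  match i with inl i => pq.1 i | inr i => pq.2 i end.
have [r rE hr] := dickson coord E.
pose a l := (tnth (in_tuple r) l).1; pose b l := (tnth (in_tuple r) l).2.
have abE l : wt (a l) = wt (b l) /\ a l != b l.
  exact: (rE _ (mem_tnth l (in_tuple r))).
have /choice[c hc] : forall l, exists e : k, vgt (wt (a l)) (X (a l) - iota e * X (b l)).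
  move=> l; rewrite (abE l).1; apply: residue_exists.
  by rewrite -(abE l).1; exact: vge_monom.
have c0 l : c l != 0.
  apply/eqP => e; have := hc l; rewrite e rmorph0 mul0r subr0; apply/negP.
  by apply: exact_vgt; case: (phi_monom (a l)).
exists (size r), a, b, c.
have gen p q : wt p = wt q ->
   (exists e, binom_comb w a b c (wt p) ('X_[p] - e *: 'X_[q])) /\
   exists d : 'I_(size r) -> int,
     expvec p - expvec q = \sum_l (expvec (a l) - expvec (b l)) *~ d l.
  have [n] := ubnP (mdeg p); elim: n p q => // n IH p q; rewrite ltnS => pn pq.
  have [<-|npq] := eqVneq p q.
    split; first by exists 1; rewrite scale1r subrr; exact: binom_comb0.
    by exists (fun=> 0); rewrite subrr big1 // => l _; rewrite mulr0z.
  have [pq0 pq0r le] := hr (p, q) (conj pq npq).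
  have [l lE] : exists l, tnth (in_tuple r) l = pq0.
    by have /tnthP[l ->] : pq0 \in in_tuple r by []; exists l.
  have ap : (a l <= p)%MM by apply/mnm_lepP => i; rewrite /a lE; exact: (le (inl i)).
  have bq : (b l <= q)%MM by apply/mnm_lepP => i; rewrite /b lE; exact: (le (inr i)).
  have [wab nab] := abE l.
  set p1 := (p - a l)%MM; set q1 := (q - b l)%MM.
  have pE : p = (p1 + a l)%MM by rewrite submK.
  have qE : q = (q1 + b l)%MM by rewrite submK.
  (* If [a l] were 0, then [b l] would have weight 0, hence be 0 and equal to [a l]. This makes the
     degree drop. *)
  have a0 : a l != 0%MM.
    apply: contraNneq nab => e; rewrite e eq_sym; apply: contraT => b0.
    by have := wt_gt0 w_gt0 b0; rewrite -wab e wt0 ltxx.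
  have p1q1 : wt p1 = wt q1.
    by apply: (@addIr _ (wt (a l))); rewrite -wtD -pE pq qE wtD wab.
  have [|[e he] [d hd]] := IH p1 q1 _ p1q1.
    by apply: leq_trans pn; rewrite pE mdegD -addn1 leq_add2l lt0n mdeg_eq0.
  split.
    exists (c l * e).
    have -> : 'X_[p] - (c l * e) *: 'X_[q] = 'X_[p1] * ('X_[a l] - c l *: 'X_[b l]) +
        c l *: ('X_[b l] * ('X_[p1] - e *: 'X_[q1])).
      rewrite pE qE !mpolyXD !mulrBr scalerBr -!scalerAr scalerA.
      by rewrite [in RHS]addrA ['X_[b l] * 'X_[p1]]mulrC subrK ['X_[b l] * _]mulrC.
    apply: binom_combD.
      rewrite pE wtD; apply: binom_combM; last exact: binom_comb_gen.
      by rewrite fps_of_mpolyX; exact: wt_homog_monom.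
    apply: binom_combZ; rewrite pE wtD wab addrC; apply: binom_combM he.
    by rewrite fps_of_mpolyX; exact: wt_homog_monom.
  exists (fun l' => d l' + (l' == l)%:R).
  under eq_bigr do rewrite mulrzDr.
  rewrite big_split -hd /= (bigD1 l) //= eqxx big1 ?addr0 => [|l' /negbTE ->]; last first.
    by rewrite mulr0z.
  by rewrite pE qE !expvecD opprD addrACA.
split=> [l|p q /gen[]|p q /gen[]//] //.
by have [? ?] := abE l; split.
Qed.

(** * From polynomials to the Rees algebra *)

Definition nneg_wt p : nneg G := NNeg (wt_ge0 w_gt0 p).

Definition rees_X p : rees v := rees_monom (g := nneg_wt p) (vge_monom p).

(** Sends U_i to x_i t^(w(u_i)), with x_i the image of u_i under [phi]; composed with the projection
    to [gr v] it gives the presentation of the graded ring. *)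
Definition rees_eval : {mpoly k[N]} -> rees v :=
  mmap (rees_const v_dom \o iota) (fun i => rees_X U_(i)%MM).

HB.instance Definition _ := GRing.RMorphism.on rees_eval.

Lemma rees_eval_X p : rees_eval 'X_[p] = rees_X p.
Proof.
rewrite /rees_eval mmapX; elim/mnm_ind: p => [|i p IH].
  rewrite mmap11; apply: val_inj; rewrite /= fps_monom0 rmorph1.
  by congr (mkmalgU _ _); apply: val_inj; rewrite /= wt0.
rewrite commr_mmap1_M => [|j x]; last exact: mulrC.
rewrite IH mmap1U; apply: val_inj; rewrite rmorphM /= malgM_def fgmulUU.
rewrite -rmorphM -fps_monomD; congr (mkmalgU _ _).
by apply: val_inj; rewrite /= wtD.
Qed.

Lemma rees_evalC e : rees_eval e%:MP = rees_const v_dom (iota e).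
Proof. by rewrite /rees_eval mmapC. Qed.

(** Both sides are additive in [P], so a single term is enough; [D'] and [C'] are the two sides as
    additive maps. *)
Lemma rees_eval_coef (P : {mpoly k[N]}) (g : nneg G) :
  monalg.mcoeff g (rees_val (rees_eval P)) = phi (wt_comp w g (fps_of_mpoly P)).
Proof.
pose C f := phi (wt_comp w g f).
have CD : zmod_morphism C.
  move=> f h; rewrite /C -rmorphB; congr (phi _); apply: fpsP => p.
  by rewrite [RHS]fpsBE /wt_comp fpsBE; case: ifP => //; rewrite subr0.
pose D (z : rees v) := monalg.mcoeff g (rees_val z).
have DD : zmod_morphism D by move=> y z; rewrite /D -monalg.mcoeffB.
pose C' : {additive {fps k[N]} -> R} := HB.pack C (GRing.isZmodMorphism.Build _ _ C CD).
pose D' : {additive rees v -> R} := HB.pack D (GRing.isZmodMorphism.Build _ _ D DD).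
change (D' (rees_eval P) = C' (fps_of_mpoly P)).
rewrite (mpolyE P) (raddf_sum (@fps_of_mpoly N k)) (raddf_sum rees_eval)
  (raddf_sum D') (raddf_sum C').
apply: eq_bigr => p _ /=.
rewrite /D /C -mul_mpolyC !rmorphM /= rees_evalC rees_eval_X fps_of_mpolyC fps_of_mpolyX.
have valE : rees_val (rees_const v_dom (iota P@_p)) * rees_val (rees_X p) =
    << iota P@_p * X p *g nneg_wt p >>.
  rewrite /= malgM_def fgmulUU; congr (mkmalgU _ _).
  by apply: val_inj; rewrite /= add0r.
rewrite valE.
have hom : wt_homog w (wt p) (fps_const P@_p * fps_monom k p).
  by rewrite -[wt p]add0r; apply: wt_homogM; [exact: wt_homog_const|exact: wt_homog_monom].
rewrite mcoeffU; case: (nneg_wt p =P g) => [<-|ne].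
  by rewrite /= (wt_comp_id hom) rmorphM phi_const.
rewrite (wt_comp_neq hom) ?rmorph0 //; apply: contra_not_neq ne => e.
exact: val_inj.
Qed.

(** * Relations modulo higher values *)

Variables (s : nat) (a b : 'I_s -> 'X_{1..N}) (c : 'I_s -> k).
Hypothesis wt_ab : forall l, wt (a l) = wt (b l).
Hypothesis vgt_ab : forall l, vgt (wt (a l)) (X (a l) - iota (c l) * X (b l)).
Hypothesis ab_generate : binoms_generate w a b c.

Local Notation B l := (fps_binom (c l) (a l) (b l)).

Lemma fps_binom_homog l : wt_homog w (wt (a l)) (B l).
Proof.
move=> p; rewrite /fps_binom => /fpsD_neq0[/fps_monom_neq0 ->//|/fpsN_neq0].
move=> /fps_mul_neq0[q [r [+ /fps_monom_neq0 -> <-]]].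
by rewrite /fps_const; case: (q =P _) => [->|]; rewrite ?eqxx ?add0m.
Qed.

Lemma phi_binom l : vgt (wt (a l)) (phi (B l)).
Proof. by rewrite rmorphB rmorphM phi_const. Qed.

Lemma phi_binom_comb g P : binom_comb w a b c g P -> vgt g (phi (fps_of_mpoly P)).
Proof.
move=> [h -> hh]; rewrite !rmorph_sum; apply: (ideal_sum (vgt_ideal v_dom g)) => l _.
rewrite !rmorphM /= fps_of_binom -[g](subrK (wt (a l))).
by apply: vgeM_gt (phi_binom l); apply: vge_phi; apply: wt_homog_ge.
Qed.

(** Modulo the binomials [P] is a single term, constant times monomial. Its image still has value
    above its weight, so the constant is 0. *)
Lemma homog_relation g P : (forall p, p \in msupp P -> wt p = g) ->
  vgt g (phi (fps_of_mpoly P)) -> binom_comb w a b c g P.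
Proof.
move=> hP; have [->|P0] := eqVneq P 0; first by move=> _; exact: binom_comb0.
have [q qP] : exists q, q \in msupp P.
  case E: (msupp P) => [|q r]; last by exists q; rewrite mem_head.
  by move/eqP: E; rewrite msupp_eq0 (negbTE P0).
have qg := hP _ qP; rewrite -{}qg in hP * => Pgt.
have [e he] := binom_comb_reduce ab_generate hP.
suff e0 : e = 0 by move: he; rewrite e0 scale0r subr0.
apply: (residue_eq0 (q := q)).
have := vgtB Pgt (phi_binom_comb he).
by rewrite -!rmorphB subKr /= fps_of_mpolyZ fps_of_mpolyX rmorphM phi_const.
Qed.

Lemma comp_relation g f : vgt g (phi (wt_comp w g f)) ->
  exists h : 'I_s -> {fps k[N]}, wt_comp w g f = \sum_l h l * B l /\
    forall l, wt_homog w (g - wt (a l)) (h l).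
Proof.
have [P -> hP] := wt_comp_mpoly w_gt0 g f => /(homog_relation hP)[h -> hh].
exists (fun l => fps_of_mpoly (h l)); split=> //.
by rewrite rmorph_sum; apply: eq_bigr => l _; rewrite rmorphM /= fps_of_binom.
Qed.

(** * Transfinite division, for the kernel of [phi] and for the toric ideal alike *)

Section Division.
Variables (F : 'I_s -> {fps k[N]}) (M : set {fps k[N]}).
Hypothesis F_init : forall l, wt_supp_gt w (wt (a l)) (F l - B l).
Hypotheses (M_ideal : is_ideal M) (F_M : forall l, M (F l)).
Hypothesis M_init : forall f g, M f -> wt_supp_ge w g f ->
  vgt g (phi (wt_comp w g f)).

(* Transfinite division: the part of least weight of the remainder is a
   combination of the binomials; subtract the same combination of the [F l]. *)
Lemma division f : M f -> exists h : 'I_s -> {fps k[N]}, f = \sum_l h l * F l.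
Proof.
move=> Mf; pose rem (h : 'I_s -> {fps k[N]}) := f - \sum_l h l * F l.
have M_rem (h : 'I_s -> {fps k[N]}) : M (rem h).
  by apply: ideal_sub => //; apply: ideal_sum => // l _; exact: ideal_mull.
pose sol g f1 : 'I_s -> {fps k[N]} := xget (fun=> 0)
  [set h : 'I_s -> {fps k[N]} | wt_comp w g f1 = \sum_l h l * B l /\
    forall l, wt_homog w (g - wt (a l)) (h l)].
(* The coefficient of u^r in the l-th quotient is fixed at the stage [wt (r + a l)], the weight of
   the leading part of u^r F_l; [part g] keeps the stages before [g]. *)
pose part g (H : G -> 'I_s -> {fps k[N]}) : 'I_s -> {fps k[N]} :=
  fun l r => if wt (r + a l)%MM < g then H (wt (r + a l)%MM) l r else 0.
have [H HE] : exists H, forall g, H g = sol g (rem (part g H)).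
  apply: (wf_recursion (fun=> 0) (wt_lt_rel_wf w_gt0)) => g H H' HH'.
  congr (sol g (rem _)); apply: funext => l; apply: fpsP => r; rewrite /part.
  by case: ifP => // rg; rewrite HH' //; split=> //; exists (r + a l)%MM.
pose h l : {fps k[N]} := fun r => H (wt (r + a l)%MM) l r.
have F_ge l : wt_supp_ge w (wt (a l)) (F l).
  rewrite -(subrK (B l) (F l)); apply: wt_supp_geD; first exact: wt_supp_gtW.
  by apply: wt_homog_ge; exact: fps_binom_homog.
have step p (h' : 'I_s -> {fps k[N]}) : wt_supp_ge w (wt p) (rem (part (wt p) H)) ->
    (forall l r, wt (r + a l)%MM <= wt p -> h' l r = h l r) ->
    wt_supp_gt w (wt p) (rem h').
  set g := wt p; set f1 := rem _ => f1g hh'.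
  have [Hsol Hhom] : wt_comp w g f1 = \sum_l H g l * B l /\
      forall l, wt_homog w (g - wt (a l)) (H g l).
    have := xgetPex (fun=> 0) (comp_relation (M_init (M_rem (part g H)) f1g)).
    by rewrite HE.
  (* All three pieces have weight above [g]: the remainder without its component of weight [g], the
     overweight terms of the [F l], and the contribution of the later stages. *)
  have -> : rem h' = (f1 - wt_comp w g f1) - \sum_l H g l * (F l - B l)
      - \sum_l (h' l - part g H l - H g l) * F l.
    rewrite Hsol /f1 /rem -!addrA; congr (f + _); rewrite -!opprD -!big_split /=.
    by congr (- _); apply: eq_bigr => l _; ring.
  apply: wt_supp_gtD; last first.
    apply/wt_supp_gtN/wt_supp_gt_sum => l.
    suff : wt_supp_gt w (wt (a l) + (g - wt (a l))) (F l * (h' l - part g H l - H g l)).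
      by rewrite addrC subrK mulrC.
    apply: wt_supp_ge_gtM => // r; rewrite -oag_leNgt; apply: contraNN => rg.
    have rag : wt (r + a l)%MM <= g by rewrite wtD -(oag_lerD2rE (- wt (a l))) addrK.
    (* Before stage [g], [h] agrees with [part g H] and [H g l] vanishes by homogeneity; at stage
       [g] the roles are exchanged. *)
    rewrite !fpsBE hh' // /h /part; case: ifPn => [lt|nlt].
      rewrite subrr sub0r oppr_eq0; apply: contraT => ne.
      have rE := Hhom l r ne; by move: lt; rewrite wtD rE subrK ltxx.
    have -> : wt (r + a l)%MM = g by apply/eqP; rewrite eq_le rag -oag_ltNge.
    by rewrite subr0 subrr.
  apply: wt_supp_gtD; first exact: wt_supp_ge_comp.
  apply/wt_supp_gtN/wt_supp_gt_sum => l.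
  suff : wt_supp_gt w (g - wt (a l) + wt (a l)) (H g l * (F l - B l)) by rewrite subrK.
  by apply: wt_supp_ge_gtM => //; apply: wt_homog_ge.
have approx p : wt_supp_ge w (wt p) (rem (part (wt p) H)).
  apply: (wt_ind w_gt0 (P := fun g => wt_supp_ge w g (rem (part g H)))) => {}p IH q ne.
  rewrite -oag_ltNge; apply/negP => qp.
  suff /(_ q ne) : wt_supp_gt w (wt q) (rem (part (wt p) H)) by rewrite ltxx.
  apply: step (IH _ qp) _ => l r rq; rewrite /part /h.
  by rewrite (le_lt_trans rq qp).
exists h; apply/eqP; rewrite -subr_eq0; apply/eqP; apply: fpsP => p.
apply/eqP; apply: contraT => ne.
suff /(_ p ne) : wt_supp_gt w (wt p) (rem h) by rewrite ltxx.
exact: step (approx p) _.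
Qed.

Lemma ideal_gen_division : M = ideal_gen (range F).
Proof.
apply/seteqP; split=> [f /division[h ->]|]; first exact: ideal_gen_lin.
by apply: ideal_gen_min => // _ [l _ <-].
Qed.

End Division.

(** [phi (B l)] has value above [wt (a l)], so it is also the image of a series of larger weight, to
    be subtracted from [B l]. *)
Lemma overweight_exists : exists F : 'I_s -> {fps k[N]}, forall l,
  phi (F l) = 0 /\ wt_supp_gt w (wt (a l)) (F l - B l).
Proof.
suff /choice[F hF] : forall l, exists f : {fps k[N]},
  phi f = 0 /\ wt_supp_gt w (wt (a l)) (f - B l) by exists F.
move=> l.
have [f fE f_gt] : exists2 f, phi f = phi (B l) & wt_supp_gt w (wt (a l)) f.
  have := phi_binom l; have [->|B0] := eqVneq (phi (B l)) 0.
    by exists 0 => [|p]; rewrite ?rmorph0 // fps0E eqxx.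
  have [p vB] := v_wt B0; rewrite /ring_gt /val_gt tofrac_eq0 (negbTE B0) vB /= => lp.
  have [f fE f_ge] := expansion_exists (exact_vge vB).
  by exists f => // q /f_ge; exact: lt_le_trans.
exists (B l - f); rewrite rmorphB fE subrr; split=> //.
by rewrite addrC addKr; exact: wt_supp_gtN.
Qed.

(** The image of the component is the negative of the image of the remaining terms, which have
    larger weight. *)
Lemma phi_comp_gt g f : wt_supp_ge w g f -> phi f = 0 -> vgt g (phi (wt_comp w g f)).
Proof.
move=> fg f0; have := vgtN (vgt_phi (wt_supp_ge_comp fg)).
by rewrite rmorphB f0 sub0r opprK.
Qed.

Lemma kernel_gen (F : 'I_s -> {fps k[N]}) :
  (forall l, phi (F l) = 0 /\ wt_supp_gt w (wt (a l)) (F l - B l)) ->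
  [set f | phi f = 0] = ideal_gen (range F).
Proof.
move=> hF; apply: ideal_gen_division => [l||l|f g f0 fg] /=.
- exact: (hF l).2.
- exact: kernel_ideal.
- exact: (hF l).1.
- exact: phi_comp_gt.
Qed.

(** * The toric ideal and its primality *)

(** The series all of whose homogeneous components vanish in the graded ring. *)
Definition toric_ideal : set {fps k[N]} := [set f | forall g, vgt g (phi (wt_comp w g f))].

Lemma toric_ideal_is_ideal : is_ideal toric_ideal.
Proof.
split=> [g|f h hf hh g|h f hf g].
- by rewrite wt_comp0 rmorph0; exact: ideal_zero (vgt_ideal v_dom g).
- by rewrite wt_compD rmorphD; exact: vgtD.
have [L ->] := wt_comp_mul w_gt0 g h f.
rewrite rmorph_sum; apply: (ideal_sum (vgt_ideal v_dom g)) => z _.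
rewrite rmorphM; suff : vgt (z + (g - z)) (phi (wt_comp w z h) * phi (wt_comp w (g - z) f)).
  by rewrite addrC subrK.
by apply: vgeM_gt (hf _); apply: vge_phi; apply: wt_homog_ge; exact: wt_comp_homog.
Qed.

(** Division by the undeformed binomials, for which the condition on components holds by
    definition. *)
Lemma toric_ideal_gen : toric_ideal = ideal_gen (range (fun l => B l)).
Proof.
apply: ideal_gen_division => [l p||l g|f g hf _].
- by rewrite subrr fps0E eqxx.
- exact: toric_ideal_is_ideal.
- have [->|ne] := eqVneq g (wt (a l)).
    by rewrite (wt_comp_id (@fps_binom_homog l)); exact: phi_binom.
  rewrite (wt_comp_neq (@fps_binom_homog l) ne) rmorph0.
  exact: ideal_zero (vgt_ideal v_dom g).
- exact: hf.
Qed.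

(** Let [g] be the least weight whose component violates the condition. Dropping the terms below [g]
    changes [f] by an element of the toric ideal, and the tail has image of value exactly [g]. *)
Lemma toric_ideal_tail f : ~ toric_ideal f ->
  exists g f', [/\ toric_ideal (f - f'), wt_supp_ge w g f', phi f' != 0 & v (phi f')%:F = g].
Proof.
move=> nf.
have [p np pmin] : exists2 p, ~~ vgt (wt p) (phi (wt_comp w (wt p) f)) &
    forall q, ~~ vgt (wt q) (phi (wt_comp w (wt q) f)) -> wt p <= wt q.
  apply: (wt_min w_gt0 (A := fun p => ~~ vgt (wt p) (phi (wt_comp w (wt p) f)))).
  apply: contrapT => nex; apply: nf => g; apply: contrapT => /negP ng.
  have [[p pg]|np] := pselect (exists p, wt p = g); first by case: nex; exists p; rewrite pg.
  case/negP: ng; rewrite (_ : wt_comp w g f = 0).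
    by rewrite rmorph0; exact: ideal_zero (vgt_ideal v_dom g).
  by apply: fpsP => p; rewrite /wt_comp; case: (wt p =P g) => // pg; case: np; exists p.
set g := wt p; pose f' := wt_tail w g f; have f'g : wt_supp_ge w g f' by exact: wt_tail_ge.
have f'_comp : wt_comp w g f' = wt_comp w g f.
  apply: fpsP => q; rewrite /wt_comp /f' /wt_tail.
  by case: eqP => // ->; rewrite lexx.
have [|f'0 vf'] := vge_exact (vge_phi f'g).
  apply: contra np => h; rewrite -f'_comp -[wt_comp _ _ _](subKr f') rmorphB.
  by apply: vgtB => //; apply: vgt_phi; exact: wt_supp_ge_comp.
exists g, f'; split=> // h.
have [gh|] := boolP (g <= h).
  rewrite (_ : wt_comp w h _ = 0).
    by rewrite rmorph0; exact: ideal_zero (vgt_ideal v_dom h).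
  apply: fpsP => q; rewrite /wt_comp fpsBE /f' /wt_tail; case: (wt q =P h) => // ->.
  by rewrite gh subrr.
rewrite oag_leNgt => hg.
rewrite (_ : wt_comp w h _ = wt_comp w h f); last first.
  apply: fpsP => q; rewrite /wt_comp fpsBE /f' /wt_tail; case: (wt q =P h) => // ->.
  by rewrite -oag_leNgt in hg; rewrite (negbTE hg) subr0.
have [[q qh]|nq] := pselect (exists q, wt q = h).
  rewrite -qh in hg *; apply: contraT => /pmin; rewrite -/g.
  by move=> /(lt_le_trans hg); rewrite ltxx.
rewrite (_ : wt_comp w h f = 0).
  by rewrite rmorph0; exact: ideal_zero (vgt_ideal v_dom h).
by apply: fpsP => q; rewrite /wt_comp; case: (wt q =P h) => // qh; case: nq; exists q.
Qed.

(** Modulo the ideal, two series outside it may be replaced by tails whose images have the least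
    possible values. By multiplicativity of [v] the product of the tails has this property too, so
    it lies outside. *)
Lemma toric_ideal_prime : prime_ideal toric_ideal.
Proof.
have idT := toric_ideal_is_ideal.
have exact_notin f g : wt_supp_ge w g f -> phi f != 0 -> v (phi f)%:F = g -> ~ toric_ideal f.
  move=> fg f0 vf /(_ g) h; have := exact_vgt f0 vf.
  rewrite -[f](subrK (wt_comp w g f)) rmorphD => /negP; apply; apply: vgtD => //.
  by apply: vgt_phi; exact: wt_supp_ge_comp.
split=> //.
  refine (exact_notin 1 0 _ _ _); first by apply: wt_homog_ge; exact: wt_homog_const.
    by rewrite rmorph1 oner_neq0.
  by rewrite rmorph1 tofrac1 val_fun1.
move=> f h fh; apply: contrapT => /not_orP[/toric_ideal_tail[g1 [f' [ff' f'g f'0 vf']]]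
  /toric_ideal_tail[g2 [h' [hh' h'g h'0 vh']]]].
apply: (exact_notin (f' * h') (g1 + g2) _ _ _ _).
- exact: wt_supp_geM.
- by rewrite rmorphM mulf_neq0.
- by rewrite rmorphM tofracM val_funM ?tofrac_neq0 // vf' vh'.
have -> : f' * h' = f * h - (f - f') * h - f' * (h - h') by ring.
apply: (ideal_sub idT); last exact: (ideal_mull idT).
by apply: (ideal_sub idT) => //; exact: (ideal_mulr idT).
Qed.

(** The initial form of [F l] is [B l], and that of a nonzero kernel element is a component whose
    image has higher value than its weight, hence a combination of the binomials. *)
Lemma initial_ideal (F : 'I_s -> {fps k[N]}) :
  (forall l, a l != b l) ->
  (forall l, phi (F l) = 0 /\ wt_supp_gt w (wt (a l)) (F l - B l)) ->
  ideal_gen (range (fun l => initial_form w (F l))) =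
  ideal_gen (initial_form w @` ideal_gen (range F)).
Proof.
move=> nab hF; rewrite -(kernel_gen hF).
have init_comp g f : wt_supp_ge w g f -> wt_comp w g f != 0 -> initial_form w f = wt_comp w g f.
  move=> fg ne; apply: fpsP => p; rewrite /initial_form /wt_comp.
  have [q fq qg] : exists2 q, f q != 0 & wt q = g.
    apply: contrapT => nex; case/eqP: ne; apply: fpsP => q; rewrite /wt_comp.
    case: (wt q =P g) => // qg; apply/eqP; apply: contraT => fq.
    by case: nex; exists q.
  case: asboolP => [pmin|npmin].
    case: (wt p =P g) => // ne'; apply/eqP; apply: contraT => fp.
    by case: ne'; apply/eqP; rewrite eq_le fg // andbT -qg pmin.
  by case: (wt p =P g) => // pg; case: npmin => r /fg; rewrite pg.
have init_F l : initial_form w (F l) = B l.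
  have Fg : wt_supp_ge w (wt (a l)) (F l).
    rewrite -(subrK (B l) (F l)); apply: wt_supp_geD.
      by apply: wt_supp_gtW; exact: (hF l).2.
    by apply: wt_homog_ge; exact: fps_binom_homog.
  have cF : wt_comp w (wt (a l)) (F l) = B l.
    rewrite -(subrK (B l) (F l)) wt_compD (wt_comp_id (@fps_binom_homog l)).
    rewrite (_ : wt_comp _ _ (_ - _) = 0) ?add0r //.
    apply: fpsP => p; rewrite /wt_comp; case: (wt p =P _) => // pa.
    by apply/eqP; apply: contraT => /(hF l).2; rewrite pa ltxx.
  rewrite (init_comp (wt (a l))) // cF; apply/eqP => /(congr1 (fun f => f (a l))).
  rewrite /fps_binom fpsBE fps_constM /fps_monom eqxx (negbTE (nab l)) mulr0 subr0.
  by apply/eqP; exact: oner_neq0.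
apply/seteqP; split; apply: ideal_gen_min; try exact: ideal_gen_ideal.
  move=> _ [l _ <-]; apply: ideal_genS; exists (F l) => //=; exact: (hF l).1.
move=> _ [f /= f0 <-]; have [->|fn0] := eqVneq f 0.
  rewrite (_ : initial_form w 0 = 0); first exact: ideal_zero (ideal_gen_ideal _).
  by apply: fpsP => p; rewrite /initial_form; case: ifP.
have [p fp pmin] : exists2 p, f p != 0 & forall q, f q != 0 -> wt p <= wt q.
  apply: (wt_min w_gt0 (A := fun p => f p != 0)); apply: contrapT => nex.
  case/eqP: fn0; apply: fpsP => p; apply/eqP; apply: contraT => fp.
  by case: nex; exists p.
rewrite (init_comp (wt p)) //; last first.
  by apply: contra_neq fp => /(congr1 (fun f => f p)); rewrite /wt_comp eqxx.
have [h [-> _]] := comp_relation (phi_comp_gt pmin f0).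
under eq_bigr do rewrite -init_F.
exact: ideal_gen_lin.
Qed.

(** * Presentation of the associated graded ring *)

Lemma fps_of_mpoly_homog g (P : {mpoly k[N]}) :
  (forall p, p \in msupp P -> wt p = g) -> wt_homog w g (fps_of_mpoly P).
Proof. by move=> hP p; rewrite /fps_of_mpoly -mcoeff_msupp => /hP. Qed.

(** The coefficients must be polynomials here: [P] is the finite sum of its components [Q g], and
    each is a combination of binomials with polynomial coefficients. *)
Lemma toric_mpolyP (P : {mpoly k[N]}) : toric_ideal (fps_of_mpoly P) ->
  ideal_gen (range (fun l => 'X_[a l] - c l *: 'X_[b l])) P.
Proof.
move=> tP; have idI := ideal_gen_ideal (range (fun l => 'X_[a l] - c l *: 'X_[b l])).
pose L := undup [seq wt p | p <- msupp P].
pose Q g := \sum_(p <- msupp P | wt p == g) P@_p *: 'X_[p].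
have -> : P = \sum_(g <- L) Q g.
  rewrite {1}(mpolyE P) (exchange_big_dep xpredT) //= big_seq [RHS]big_seq.
  apply: eq_bigr => p pP.
  have pL : wt p \in L by rewrite mem_undup; apply: map_f.
  rewrite big_mkcond (bigD1_seq _ pL) ?undup_uniq //= eqxx big1 ?addr0 // => g.
  by rewrite eq_sym => /negbTE ->.
apply: (ideal_sum idI) => g _.
have QE : fps_of_mpoly (Q g) = wt_comp w g (fps_of_mpoly P).
  apply: fpsP => p; rewrite /fps_of_mpoly /wt_comp raddf_sum /=.
  under eq_bigr do rewrite mcoeffZ mcoeffX.
  have [pP|pP] := boolP (p \in msupp P); last first.
    rewrite big1_seq => [|q /andP[_ qP]].
      by rewrite (memN_msupp_eq0 pP) if_same.
    by case: (q =P p) => [e|]; rewrite ?mulr0 //; rewrite e (negbTE pP) in qP.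
  rewrite big_mkcond (bigD1_seq _ pP) ?msupp_uniq //= eqxx mulr1 big1 ?addr0 // => q.
  by move=> /negbTE ->; rewrite mulr0 if_same.
have hQ : forall p, p \in msupp (Q g) -> wt p = g.
  move=> p; rewrite mcoeff_msupp => Qp.
  by apply: (@wt_comp_homog _ _ w _ g (fps_of_mpoly P) p); rewrite -QE.
have [|h -> _] := homog_relation hQ.
  by rewrite QE.
exact: ideal_gen_lin.
Qed.

Lemma toric_binom l : toric_ideal (fps_of_mpoly ('X_[a l] - c l *: 'X_[b l])).
Proof.
rewrite fps_of_binom; rewrite toric_ideal_gen.
by apply: ideal_genS; exists l.
Qed.

Definition gr_pi : {rmorphism rees v -> gr v} := \pi_({ideal_quot (rees_plus (v := v))}).

Lemma gr_pi_eq0 (z : rees v) :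
  gr_pi z = 0 <-> forall g : nneg G, vgt g (monalg.mcoeff g (rees_val z)).
Proof.
rewrite /gr_pi; split.
  move=> /eqP; rewrite -(rmorph0 (\pi_({ideal_quot (rees_plus (v := v))}))).
  by rewrite -Quotient.idealrBE subr0 => /asboolP.
move=> h; apply/eqP; rewrite -(rmorph0 (\pi_({ideal_quot (rees_plus (v := v))}))).
by rewrite -Quotient.idealrBE subr0; apply/asboolP.
Qed.

Lemma toric_rees (P : {mpoly k[N]}) :
  gr_pi (rees_eval P) = 0 <-> toric_ideal (fps_of_mpoly P).
Proof.
rewrite gr_pi_eq0; split=> [h g|h g]; last by rewrite rees_eval_coef.
have [g0|] := boolP (0 <= g); first by have := h (NNeg g0); rewrite rees_eval_coef.
move=> ng; rewrite (_ : wt_comp w g _ = 0).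
  by rewrite rmorph0; exact: ideal_zero (vgt_ideal v_dom g).
apply: fpsP => p; rewrite /wt_comp; case: (wt p =P g) => // pg.
by rewrite -pg (wt_ge0 w_gt0) in ng.
Qed.

(** Each of the finitely many coefficients of a lift to the Rees algebra agrees, modulo higher
    values, with the image of 0 or of a constant times a monomial of the right weight. *)
Lemma rees_eval_surj (z : gr v) : exists P, gr_pi (rees_eval P) = z.
Proof.
have [u <-] : exists u, gr_pi u = z.
  by exists (repr (z : {ideal_quot (rees_plus (v := v))})); exact: reprK.
pose fc (g : nneg G) := monalg.mcoeff g (rees_val u).
have fge (g : nneg G) : vge g (fc g) by have /asboolP := rees_valP u; apply.
have /choice[Q hQ] : forall g : nneg G, exists Q : {mpoly k[N]},
    wt_homog w g (fps_of_mpoly Q) /\ vgt g (fc g - phi (fps_of_mpoly Q)).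
  move=> g; have [fg|/(vge_exact (fge g))[f0 vf]] := boolP (vgt g (fc g)).
    by exists 0; rewrite !rmorph0 subr0; split=> //; exact: wt_homog0.
  have [q vq] := v_wt f0; have qg : wt q = g by rewrite -vq.
  have [|e he] := @residue_exists q (fc g).
    by rewrite qg.
  exists (e *: 'X_[q]); rewrite fps_of_mpolyZ fps_of_mpolyX; split.
    rewrite -qg -[wt q]add0r; apply: wt_homogM; [exact: wt_homog_const|exact: wt_homog_monom].
  by rewrite rmorphM phi_const -qg.
pose L : seq (nneg G) := finmap.enum_fset (monalg.msupp (rees_val u)).
pose P := \sum_(g <- L) Q g.
exists P; apply/eqP; rewrite -subr_eq0 -rmorphB; apply/eqP/gr_pi_eq0 => g.
rewrite [rees_val _]/= monalg.mcoeffB rees_eval_coef.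
have compP : wt_comp w g (fps_of_mpoly P) = if g \in L then fps_of_mpoly (Q g) else 0.
  rewrite /P rmorph_sum /=.
  have -> (r : seq (nneg G)) : wt_comp w g (\sum_(g' <- r) fps_of_mpoly (Q g')) =
      \sum_(g' <- r) if g' == g then fps_of_mpoly (Q g') else 0.
    elim: r => [|g' r IH]; first by rewrite !big_nil wt_comp0.
    rewrite !big_cons wt_compD IH; congr (_ + _).
    case: (g' =P g) => [->|ne]; first exact: wt_comp_id (hQ g).1.
    by apply: wt_comp_neq (hQ g').1 _; apply: contra_not_neq ne => e; exact: val_inj.
  case: ifPn => gL; last first.
    rewrite big1_seq // => g' /andP[_ g'L]; case: (g' =P g) => // e.
    by rewrite e (negbTE gL) in g'L.
  rewrite (bigD1_seq _ gL) ?finmap.fset_uniq //= eqxx big1 ?addr0 // => g'.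
  by move=> /negbTE ->.
rewrite compP; case: ifPn => gL.
  by rewrite -opprB; apply: vgtN; exact: (hQ g).2.
rewrite rmorph0 sub0r mcoeff_outdom // oppr0.
exact: ideal_zero (vgt_ideal v_dom g).
Qed.

Lemma gr_presented : gr_presented_by iota v w a b c.
Proof.
have [J JE [psi [psi_inj psiE]]] := quotient_by_kernel (gr_pi \o rees_eval).
exists J.
  rewrite JE; apply/seteqP; split=> [P /= /toric_rees/toric_mpolyP //|].
  apply: ideal_gen_min; first exact: kernel_ideal.
  by move=> _ [l _ <-]; apply/toric_rees; exact: toric_binom.
exists psi; split.
- have /choice[r hr] : forall z, exists t, psi t = z.
    by move=> z; have [P <-] := rees_eval_surj z; exists (\pi P); rewrite psiE.
  by exists r => // t; apply: psi_inj.
- by move=> e; exists (rees_eval e%:MP); rewrite ?psiE // rees_evalC.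
- move=> g P hP; exists (phi (fps_of_mpoly P)), (rees_eval P); last by rewrite psiE.
  apply/malgP => g'; rewrite rees_eval_coef mcoeffU.
  case: (g =P g') => [<-|ne].
    by rewrite (wt_comp_id (fps_of_mpoly_homog hP)).
  rewrite (wt_comp_neq (fps_of_mpoly_homog hP)) ?rmorph0 //.
  by apply: contra_not_neq ne => e; apply: val_inj.
Qed.

End WeightedPresentation.

(** * Weights from generators of the value semigroup *)

Lemma weight_exists (N : nat) (G : orderedAbGroupType) (gamma : 'I_N -> G) :
  exists w : {additive 'rV[int]_N -> G},
    forall p, wt w p = \sum_i gamma i *+ p i.
Proof.
pose w0 (z : 'rV[int]_N) : G := \sum_i gamma i *~ z 0 i.
have w0B : zmod_morphism w0.
  by move=> y z; rewrite -sumrB; apply: eq_bigr => i _; rewrite !mxE mulrzBr.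
exists (HB.pack w0 (GRing.isZmodMorphism.Build _ _ w0 w0B) : {additive 'rV[int]_N -> G}).
by move=> p; apply: eq_bigr => i _; rewrite mxE.
Qed.

(** Used to write a vector of the relation lattice as a difference of two exponents. *)
Lemma int_pos_neg (t : int) : t = (absz (Num.max t 0))%:Z - (absz (Num.max (- t) 0))%:Z.
Proof.
case: t => n; first by rewrite max_l // max_r ?oppr_le0 // subr0.
by rewrite NegzE opprK max_r ?oppr_le0 // max_l // sub0r.
Qed.

(** Zero generators are discarded; the others are positive because all of [Gamma] is nonnegative. *)
Lemma positive_generators (G : orderedAbGroupType) (Gamma : set G) :
  (forall g, Gamma g -> 0 <= g) -> fg_semigroup Gamma ->
  exists (N : nat) (gamma : 'I_N -> G),
    (forall i, 0 < gamma i) /\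
    Gamma = [set \sum_i gamma i *+ a i | a in [set: 'I_N -> nat]].
Proof.
move=> Gamma_ge0 [r [g GammaE]].
have gGamma i : Gamma (g i).
  rewrite GammaE; exists (fun j => (j == i) : nat) => //.
  by rewrite (bigD1 i) //= eqxx big1 ?addr0 // => j /negbTE ->.
pose A := [pred i | g i != 0].
have sumA (a : 'I_r -> nat) :
    \sum_i g i *+ a i = \sum_(j < #|A|) g (enum_val j) *+ a (enum_val j).
  rewrite -(big_enum_val (A := A) (fun i => g i *+ a i)) [RHS]big_mkcond /=.
  by apply: eq_bigr => i _; case: ifPn => //; rewrite negbK => /eqP ->; rewrite mul0rn.
exists #|A|, (fun j => g (enum_val j)); split.
  by move=> j; have := enum_valP j; rewrite inE lt_neqAle eq_sym => ->; rewrite Gamma_ge0.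
rewrite GammaE; apply/seteqP; split=> _ [a _ <-].
  by exists (fun j => a (enum_val j)); rewrite ?sumA.
(* Multiplicities outside [A] may be anything, since those generators are 0. *)
exists (fun i => if pselect (i \in A) is left Ai then a (enum_rank_in Ai i) else 0%N) => //.
rewrite sumA; apply: eq_bigr => j _; case: pselect => [Aj|]; last by case; exact: enum_valP.
by rewrite enum_valK_in.
Qed.

(** * The deformation attached to generators of the value semigroup *)

Theorem proposition5p1
  (k : closedFieldType) (R : idomainType) (m : set R)
  (iota : {rmorphism k -> R})
  (Phi : orderedAbGroupType) (nu : valuation {fraction R} Phi)
  (R_local : local_ring m)
  (R_noetherian : noetherian R)
  (R_complete : adic_complete m)
  (R_equichar : equicharacteristic m)
  (k_repr : field_of_representatives m iota)
  (nu_dominates : dominates nu m)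
  (nu_rational : rational_valuation nu)
  (nu_fg : fg_semigroup (value_semigroup nu)) :
  is_overweight_deformation_of_gr iota nu.
Proof.
have [|N [gamma [gamma_gt0 valE]]] := positive_generators _ nu_fg.
  move=> _ [x x0 <-]; have := vge0 nu_dominates x.
  by rewrite /ring_ge /val_ge tofrac_eq0 (negbTE x0).
have [w wE] := weight_exists gamma.
have wU i : wt w U_(i)%MM = gamma i.
  rewrite wE (bigD1 i) //= mnm1E eqxx big1 ?addr0 // => j.
  by rewrite mnm1E eq_sym => /negbTE ->.
have w_gt0 i : 0 < wt w U_(i)%MM by rewrite wU.
have v_wt (x : R) : x != 0 -> exists p, nu x%:F = wt w p.
  move=> x0; have : value_semigroup nu (nu x%:F) by exists x.
  rewrite valE => -[a _ <-]; exists [multinom a i | i < N].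
  by rewrite wE; apply: eq_bigr => i _; rewrite mnmE.
have /choice[xi xiE] : forall i, exists x : R, x != 0 /\ nu x%:F = gamma i.
  move=> i; have : value_semigroup nu (gamma i).
    rewrite valE; exists (fun j => (j == i) : nat) => //.
    by rewrite (bigD1 i) //= eqxx big1 ?addr0 // => j /negbTE ->.
  by move=> [x x0 <-]; exists x.
(* Positivity of the generators puts the [xi i] in [m], so that power series can be evaluated at
   them. *)
have xi_m i : m (xi i).
  by apply/nu_dominates.2; rewrite /val_gt (xiE i).2 gamma_gt0 orbT.
have [phi phiE] := fps_eval_exists iota R_complete xi_m.
have phi_const e : phi (fps_const e) = iota e.
  by rewrite -fps_of_mpolyC phiE mmapC.
have phi_monom p : phi (fps_monom k p) != 0 /\ nu (phi (fps_monom k p))%:F = wt w p.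
  rewrite -fps_of_mpolyX phiE mmapX; elim/mnm_ind: p => [|i p [p0 vp]].
    by rewrite mmap11 oner_neq0 tofrac1 val_fun1 wt0.
  have [xi0 vxi] := xiE i.
  rewrite commr_mmap1_M => [|j x]; last exact: mulrC.
  rewrite mmap1U mulf_neq0 // tofracM val_funM ?tofrac_neq0 //.
  by rewrite vp vxi wtD wU.
have [s [a [b [c [ab_spec gen lattice]]]]] :=
  binomials_exist nu_dominates nu_rational k_repr w_gt0 phi_monom.
have wt_ab l : wt w (a l) = wt w (b l) by case: (ab_spec l).
have vgt_ab l : ring_gt nu (wt w (a l))
  (phi (fps_monom k (a l)) - iota (c l) * phi (fps_monom k (b l))) by case: (ab_spec l).
have [F hF] := overweight_exists nu_dominates nu_rational k_repr w_gt0 v_wt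
  phi_const phi_monom vgt_ab.
have kerE := kernel_gen nu_dominates w_gt0 phi_const phi_monom wt_ab vgt_ab gen hF.
have expand x g := expansion_exists (x := x) (g := g) nu_dominates nu_rational k_repr
  w_gt0 v_wt phi_const phi_monom.
exists N, s, w, a, b, c, F; split=> //.
- split.
  + exact: wt_ge0.
  + by move=> l; case: (ab_spec l).
  + rewrite -(toric_ideal_gen nu_dominates w_gt0 phi_const phi_monom wt_ab vgt_ab gen).
    exact: (toric_ideal_prime nu_dominates w_gt0 phi_monom).
  + move=> z; split=> [wz0|[d ->]]; last first.
      rewrite raddf_sum big1 // => l _.
      by rewrite raddfMz raddfB -[w _]/(wt w (a l)) wt_ab subrr mul0rz.
    (* The positive and negative parts of a relation [z] are exponents of equal weight, to which the
       lattice statement for pairs applies. *)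
    pose pos (z : 'rV[int]_N) i := absz (Num.max (z 0 i) 0).
    pose p := [multinom pos z i | i < N]; pose q := [multinom pos (- z) i | i < N].
    have zE : z = expvec p - expvec q.
      by apply/rowP => i; rewrite !mxE !mnmE /pos !mxE; exact: int_pos_neg.
    have pq : wt w p = wt w q by apply/eqP; rewrite -subr_eq0 -raddfB -zE wz0.
    by rewrite zE; exact: lattice.
  + split=> [l p|]; first exact: (hF l).2.
    apply: (initial_ideal nu_dominates w_gt0 phi_const phi_monom wt_ab vgt_ab gen) => // l.
    by case: (ab_spec l).
- have [I IE [psi [psi_inj psiE]]] := quotient_by_kernel phi.
  (* Such a lift gives surjectivity and also attains the maximum that defines the valuation. *)
  have surj y : exists f, psi (\pi_({ideal_quot I}) f) = y /\
      wt_supp_ge w (nu y%:F) f.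
    have [|f fy fg] := expand y (nu y%:F); first exact: exact_vge.
    by exists f; rewrite psiE.
  exists I; first by rewrite IE kerE.
  exists psi; split=> [|e|x x0].
  + have /choice[r hr] : forall y, exists x, psi x = y.
      by move=> y; have [f [fy _]] := surj y; exists (\pi f).
    by exists r => // x; apply: psi_inj.
  + by rewrite psiE.
  set y := psi x; have y0 : y != 0 by rewrite -(rmorph0 psi) (inj_eq psi_inj).
  have [f [fy fg]] := surj y; have fx : x = \pi_({ideal_quot I}) f by apply: psi_inj.
  have phif : phi f = y by rewrite -psiE fy.
  split.
    exists f => //; split=> //; apply: contrapT => nex.
    (* If no term of [f] had weight equal to the value of [y], all would have larger weight, and so
       would the value of [phi f = y]. *)
    suff : ring_gt nu (nu y%:F) (phi f) by rewrite phif (negbTE (exact_vgt y0 erefl)).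
    apply: (vgt_phi nu_dominates phi_monom) => p fp.
    rewrite lt_neqAle fg // andbT; apply/eqP => e.
    by apply: nex; exists p.
  (* No lift has larger weight, as the value of the image is at least the weight. *)
  move=> f' g f'x [_ f'h]; have := vge_phi nu_dominates phi_monom f'h.
  by rewrite -psiE -f'x /ring_ge /val_ge tofrac_eq0 (negbTE y0).
- exact: (gr_presented nu_dominates nu_rational k_repr w_gt0 v_wt phi_const phi_monom
    wt_ab vgt_ab gen).
Qed.
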